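(* Let $X$ be a completely regular space, $A$ a completely closed subset of $X$, $(\beta X,\beta A)$ the pair of Stone–Čech compactifications (with $\beta A$ identified with the closure of $A$ in $\beta X$), $n$ an integer, and $G$, $M$ abelian groups. Then $\check{H}_n(\beta X,\beta A;G)\cong M$ if and only if $\check{H}_n^F(X,A;G)\cong M$; and $\hat{H}^n(\beta X,\beta A;G)\cong M$ if and only if $\hat{H}_F^n(X,A;G)\cong M$.
   Context: Completely regular spaces are Tychonoff spaces. A subset $A\subset X$ is completely closed if it is closed and every continuous map $A\to[0,1]$ extends to a continuous map $X\to[0,1]$. A subset $U\subset X$ is functionally open if $U=f^{-1}((0,1])$ for some continuous $f:X\to[0,1]$. Let $cov_F(X)$ be the set of finite indexed covers $\alpha=\{\alpha_v\}_{v\in V_\alpha}$ of $X$ by functionally open sets, directed by refinement: $\alpha\le\alpha'$ iff every member of $\alpha'$ is contained in a member of $\alpha$. For $\alpha\in cov_F(X)$ the nerve $X_\alpha$ is the simplicial complex of nonempty finite $s\subset V_\alpha$ with $\bigcap_{v\in s}\alpha_v\neq\emptyset$, and $A_\alpha\subset X_\alpha$ is the subcomplex of those $s$ with $A\cap\bigcap_{v\in s}\alpha_v\ne\emptyset$. $H_n(X_\alpha,A_\alpha;G)$ and $H^n(X_\alpha,A_\alpha;G)$ are the simplicial homology and cohomology groups with coefficients in $G$. For $\alpha\le\alpha'$ any refinement projection $p_{\alpha\alpha'}:V_{\alpha'}\to V_\alpha$ (with $\alpha'_{v}\subset\alpha_{p_{\alpha\alpha'}(v)}$) is a simplicial map $(X_{\alpha'},A_{\alpha'})\to(X_\alpha,A_\alpha)$;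 the induced homomorphisms $p_{\alpha\alpha'*}$ on homology and $p_{\alpha\alpha'}^*$ on cohomology do not depend on its choice. The functional homology and cohomology groups are $$\check H_n^F(X,A;G)=\varprojlim\{H_n(X_\alpha,A_\alpha;G),p_{\alpha\alpha'*},cov_F(X)\},\quad \hat H^n_F(X,A;G)=\varinjlim\{H^n(X_\alpha,A_\alpha;G),p^*_{\alpha\alpha'},cov_F(X)\}.$$ The groups $\check H_n(\beta X,\beta A;G)$ and $\hat H^n(\beta X,\beta A;G)$ are the usual Čech homology and cohomology groups of the compact pair $(\beta X,\beta A)$, defined by the same limits taken over all open covers of $\beta X$ (equivalently, over all finite open covers) in place of $cov_F$. *)

(* Defs.v *)
From HB Require Import structures.
From mathcomp Require Import all_boot all_order all_algebra finmap.
From mathcomp Require Import all_classical all_reals all_analysis.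

Set Implicit Arguments.
Unset Strict Implicit.
Unset Printing Implicit Defensive.

Import Order.TTheory GRing.Theory Num.Theory.
Import numFieldNormedType.Exports.

Local Open Scope classical_set_scope.
Local Open Scope ring_scope.

Definition isomorphic (U V : zmodType) : Prop :=
  exists f : {additive U -> V}, bijective f.

Section Subquotient.
Variables (C : zmodType) (Z B : zmodClosed C).

Record subgroup_of := SubgroupOf { sg_val : C; _ : sg_val \in Z }.

HB.instance Definition _ := [isSub for sg_val].
HB.instance Definition _ := [Choice of subgroup_of by <:].
HB.instance Definition _ := [SubChoice_isSubZmodule of subgroup_of by <:].

Definition in_denominator : {pred subgroup_of} := fun z => val z \in B.

Lemma in_denominatorE z : (z \in in_denominator) = (val z \in B).
Proof. by []. Qed.

Fact in_denominator_closed : zmod_closed in_denominator.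
Proof.
split; first by rewrite in_denominatorE raddf0 rpred0.
by move=> x y; rewrite !in_denominatorE raddfB => xB yB; rewrite rpredB.
Qed.

HB.instance Definition _ :=
  GRing.isZmodClosed.Build subgroup_of in_denominator in_denominator_closed.

(* Z / (Z :&: B) *)
Definition subquotient : zmodType := Quotient.quot in_denominator.

Definition subquotient_class (z : subgroup_of) : subquotient :=
  \pi_(Quotient.quot in_denominator)%qT z.

Lemma subquotient_classP x y :
  (subquotient_class x == subquotient_class y) = (val (x - y) \in B).
Proof. by rewrite -in_denominatorE Quotient.idealrBE. Qed.

Fact subquotient_class_zmod_morphism : zmod_morphism subquotient_class.
Proof. by move=> x y; rewrite /subquotient_class !piE. Qed.

HB.instance Definition _ := GRing.isZmodMorphism.Build subgroup_of subquotient
  subquotient_class subquotient_class_zmod_morphism.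

Definition subquotient_repr (h : subquotient) : subgroup_of :=
  repr (h : Quotient.quot in_denominator).

Lemma subquotient_reprK : cancel subquotient_repr subquotient_class.
Proof. by move=> h; rewrite /subquotient_class reprK. Qed.

End Subquotient.

Section SubquotientMap.
Variables (C C' : zmodType) (Z B : zmodClosed C) (Z' B' : zmodClosed C').
Variable f : C -> C'.
Hypothesis fZ : forall c, c \in Z -> f c \in Z'.
Hypothesis fB : forall c, c \in Z -> c \in B -> f c \in B'.
Hypothesis fD : {in Z &, {morph f : x y / x - y}}.

Definition subgroup_map (z : subgroup_of Z) : subgroup_of Z' :=
  SubgroupOf (fZ (valP z)).

Definition subquotient_map (h : subquotient Z B) : subquotient Z' B' :=
  subquotient_class B' (subgroup_map (subquotient_repr h)).

Lemma subquotient_mapE (z : subgroup_of Z) :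
  subquotient_map (subquotient_class B z) =
  subquotient_class B' (subgroup_map z).
Proof.
apply/eqP; rewrite subquotient_classP raddfB /=.
set y := subquotient_repr _.
rewrite -fD ?(valP y) ?(valP z)//; apply: fB.
  by rewrite rpredB ?(valP y) ?(valP z).
suff: subquotient_class B y == subquotient_class B z.
  by rewrite subquotient_classP raddfB.
by rewrite /y subquotient_reprK.
Qed.

Fact subquotient_map_zmod_morphism : zmod_morphism subquotient_map.
Proof.
move=> x y; rewrite -(subquotient_reprK x) -(subquotient_reprK y) -raddfB.
rewrite !subquotient_mapE -raddfB; congr subquotient_class; apply: val_inj.
by rewrite raddfB /= -fD ?raddfB// ?(valP (subquotient_repr _)).
Qed.

#[local]
HB.instance Definition _ := GRing.isZmodMorphism.Build (subquotient Z B)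
  (subquotient Z' B') subquotient_map subquotient_map_zmod_morphism.

Definition subquotient_morphism :
  {additive subquotient Z B -> subquotient Z' B'} := subquotient_map.

End SubquotientMap.

Section Limits.
Variables (I : Type) (H : I -> zmodType) (Arr : I -> I -> Type).

(* I indexes the groups of a diagram, Arr i j its arrows from i to j. No
   directedness is built in: the limits below are those of arbitrary diagrams. *)
Definition product := forall i, H i.

HB.instance Definition _ := gen_eqMixin product.
HB.instance Definition _ := gen_choiceMixin product.

Fact product_addA : associative (fun x y : product => fun i => x i + y i).
Proof. by move=> x y z; apply: functional_extensionality_dep => i; rewrite addrA. Qed.

Fact product_addC : commutative (fun x y : product => fun i => x i + y i).
Proof. by move=> x y; apply: functional_extensionality_dep => i; rewrite addrC. Qed.

Fact product_add0 :
  left_id ((fun=> 0) : product) (fun x y : product => fun i => x i + y i).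
Proof. by move=> x; apply: functional_extensionality_dep => i; rewrite add0r. Qed.

Fact product_addN : left_inverse ((fun=> 0) : product)
  (fun x : product => fun i => - x i) (fun x y : product => fun i => x i + y i).
Proof. by move=> x; apply: functional_extensionality_dep => i; rewrite addNr. Qed.

HB.instance Definition _ := GRing.isZmodule.Build product
  product_addA product_addC product_add0 product_addN.

Lemma productB (x y : product) i : (x - y) i = x i - y i.
Proof. by []. Qed.

Section InverseLimit.
Variable tr : forall i j, Arr i j -> {additive H i -> H j}.

Definition thread : {pred product} :=
  fun x => `[< forall i j (a : Arr i j), tr a (x i) = x j >].

Fact thread_closed : zmod_closed thread.
Proof.
split; first by apply/asboolP => i j a; rewrite raddf0.
move=> x y /asboolP xT /asboolP yT; apply/asboolP => i j a.
by rewrite !productB raddfB xT yT.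
Qed.

HB.instance Definition _ := GRing.isZmodClosed.Build product thread thread_closed.

Definition inverse_limit : zmodType := subgroup_of thread.
End InverseLimit.

Section DirectLimit.
Variable tr : forall i j, Arr i j -> {additive H i -> H j}.

Definition finitely_supported : {pred product} :=
  fun x => `[< finite_set [set i | x i != 0] >].

Fact finitely_supported_closed : zmod_closed finitely_supported.
Proof.
split.
  by apply/asboolP; rewrite (_ : mkset _ = set0)//; apply/seteqP; split=> i //=; rewrite eqxx.
move=> x y /asboolP xf /asboolP yf; apply/asboolP.
apply: (@sub_finite_set _ _ ([set i | x i != 0] `|` [set i | y i != 0])).
  move=> i /=; rewrite productB; have [->|] := eqVneq (x i) 0; last by left.
  by have [->|] := eqVneq (y i) 0; [rewrite subrr eqxx|right].
by rewrite finite_setU.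
Qed.

HB.instance Definition _ := GRing.isZmodClosed.Build product
  finitely_supported finitely_supported_closed.

Definition single (i : I) (x : H i) : product :=
  @dfwith {classic I} (fun i : {classic I} => H i) (fun=> 0) i x.

(* The subgroup generated by the elements x - tr a x *)
Definition identified : {pred product} := fun c =>
  `[< forall S : zmodClosed product,
        (forall i j (a : Arr i j) (x : H i),
           single x - single (tr a x) \in S) -> c \in S >].

Fact identified_closed : zmod_closed identified.
Proof.
split; first by apply/asboolP => S _; rewrite rpred0.
move=> x y /asboolP xR /asboolP yR; apply/asboolP => S SR.
by rewrite rpredB ?xR ?yR.
Qed.

HB.instance Definition _ :=
  GRing.isZmodClosed.Build product identified identified_closed.

(* The direct sum of the H i modulo the identifications x = tr a x *)
Definition direct_limit : zmodType := subquotient finitely_supported identified.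
End DirectLimit.
End Limits.

Section FiniteSums.
Variables (G : zmodType).

Lemma subr_neq0P (x y : G) : x - y != 0 -> x != 0 \/ y != 0.
Proof.
have [->|] := eqVneq x 0; last by left.
by have [->|] := eqVneq y 0; [rewrite subrr eqxx|right].
Qed.

Lemma finite_suppB (T : Type) (c d : T -> G) :
  finite_set [set v | c v != 0] -> finite_set [set v | d v != 0] ->
  finite_set [set v | (c - d) v != 0].
Proof.
move=> cf df.
apply: (@sub_finite_set _ _ ([set v | c v != 0] `|` [set v | d v != 0])).
  by move=> v; exact: subr_neq0P.
by rewrite finite_setU.
Qed.

Lemma fsum_seq (T : choiceType) (r : seq T) (P : set T) (F : T -> G) :
  uniq r -> (forall v, v \notin r -> F v = 0) ->
  \sum_(v \in P) F v = \sum_(v <- r | v \in P) F v.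
Proof.
move=> ur F0; rewrite [RHS]bigfs ?set_mem_set//.
by move=> i _; exact: F0.
Qed.

Lemma supp_seq (T : choiceType) (F : T -> G) : finite_set [set v | F v != 0] ->
  exists2 r : seq T, uniq r & forall v, v \notin r -> F v = 0.
Proof.
move=> Ff; exists (enum_fset (fset_set [set v | F v != 0])); first exact: fset_uniq.
move=> v; rewrite in_fset_set// => h; apply/eqP/negP => /negP Fv.
by case/negP: h; rewrite inE.
Qed.

Lemma fsumB (T : choiceType) (P : set T) (F E : T -> G) :
  finite_set [set v | F v != 0] -> finite_set [set v | E v != 0] ->
  \sum_(v \in P) (F v - E v) = \sum_(v \in P) F v - \sum_(v \in P) E v.
Proof.
move=> /supp_seq[r ur F0] /supp_seq[r' ur' E0].
have uS : uniq (undup (r ++ r')) by exact: undup_uniq.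
have S1 v : v \notin undup (r ++ r') -> F v = 0 /\ E v = 0.
  by rewrite mem_undup mem_cat negb_or => /andP[/F0 -> /E0 ->].
rewrite !(fsum_seq _ uS) ?sumrB// => v /S1[Fv Ev]//.
by rewrite Fv Ev subrr.
Qed.

Lemma fsumN (T : choiceType) (P : set T) (F : T -> G) :
  finite_set [set v | F v != 0] ->
  \sum_(v \in P) (- F v) = - \sum_(v \in P) F v.
Proof.
move=> /supp_seq[r ur F0].
by rewrite !(fsum_seq _ ur) ?sumrN// => v /F0 ->; rewrite oppr0.
Qed.

Lemma fsum_neq0 (T : choiceType) (P : set T) (F : T -> G) :
  \sum_(v \in P) F v != 0 -> exists2 v, P v & F v != 0.
Proof.
apply: contra_neqP => /forall2NP PF; apply: fsbig1 => v Pv.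
by have [//|/negP/negPn/eqP] := PF v.
Qed.

Lemma fsum_fibre (T U : choiceType) (h : T -> U) (D : set T) (P : set U)
    (F : T -> G) : finite_set [set v | F v != 0] ->
  \sum_(z \in P) \sum_(u \in D `&` h @^-1` [set z]) F u =
  \sum_(u \in D `&` h @^-1` P) F u.
Proof.
move=> /supp_seq[r ur F0].
under eq_fsbigr do rewrite (fsum_seq _ ur F0).
rewrite (fsum_seq _ ur F0).
rewrite (@fsum_seq _ (undup (map h r)))//; last first.
- move=> z; rewrite mem_undup => zr; rewrite big_seq_cond big1// => u.
  move=> /andP[ur' /set_mem[_ /= hu]].
  by case/negP: zr; rewrite -hu map_f.
- exact: undup_uniq.
rewrite (exchange_big_dep (fun u => u \in D `&` h @^-1` P))/=; last first.
  move=> z u /set_mem Pz /set_mem[Du /= huz]; apply/mem_set; split => //=.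
  by rewrite huz.
rewrite big_seq_cond [RHS]big_seq_cond; apply: eq_bigr => u.
move=> /andP[ru /set_mem[Du /= Pu]].
rewrite -big_filter (_ : seq.filter _ _ = [:: h u]) ?big_seq1//.
rewrite (@eq_filter _ _ (pred1 (h u))).
  by rewrite filter_pred1_uniq ?undup_uniq// mem_undup map_f.
move=> z /=; apply/andP/eqP; first by move=> [_ /set_mem[_ /= ->]].
by move=> ->; split; apply/mem_set.
Qed.

Lemma fsum_involution (T : choiceType) (P : set T) (phi : T -> T) (F : T -> G) :
  finite_set [set v | F v != 0] ->
  (forall u, P u -> P (phi u)) ->
  (forall u, P u -> F u != 0 -> phi u != u) ->
  (forall u, phi (phi u) = u) ->
  (forall u, P u -> F (phi u) = - F u) -> \sum_(v \in P) F v = 0.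
Proof.
move=> Ff Pphi phi1 phiK Fphi.
pose S := fset_set (P `&` [set v | F v != 0]).
have fS : finite_set (P `&` [set v | F v != 0]) by exact: finite_setIr.
have -> : \sum_(v \in P) F v = \sum_(v <- enum_fset S) F v.
  rewrite fsbig_supp -fsbig_finite//; last first.
  apply: eq_fsbigl; apply/seteqP; split=> v /= [Pv Fv]; split=> //; exact/eqP.
have : forall u, u \in (enum_fset S) -> [/\ phi u \in (enum_fset S), phi u != u & F (phi u) = - F u].
  move=> u; rewrite in_fset_set// inE => -[/= Pu Fu].
  rewrite in_fset_set// inE /= Fphi// oppr_eq0; split => //; first by split => //; exact: Pphi.
  exact: phi1.
have := fset_uniq S.
move: (enum_fset S) => {S fS} r.
have [m] := ubnP (size r); elim: m r => // m IH [|u r] sr ur hr.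
  by rewrite big_nil.
have [] := hr u; first by rewrite inE eqxx.
rewrite inE => /orP[->//|pr] pu Fu.
have /(perm_big _)-> : perm_eq (u :: r) (u :: phi u :: rem (phi u) r).
  by rewrite perm_cons perm_to_rem.
rewrite !big_cons /= Fu addrA subrr add0r.
move: ur => /= /andP[unr ur].
apply: IH.
- by move: sr => /=; rewrite size_rem//; case: (r) pr => //= a l _; rewrite !ltnS => /ltnW.
- exact: rem_uniq.
move=> v; rewrite mem_rem_uniq// inE => /andP[vphi vr].
have [] := hr v; first by rewrite inE vr orbT.
rewrite inE => /orP[/eqP phv|phvr] phvv Fv.
  by case/eqP: vphi; rewrite /= -phv phiK.
split=> //; rewrite mem_rem_uniq// inE phvr andbT.
apply: contraNneq unr => /(congr1 phi).
by rewrite !phiK => <-.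
Qed.

End FiniteSums.

Record simplicial_complex (V : Type) := SimplicialComplex {
  simplex : set (set V);
  simplex_finite : forall s, simplex s -> finite_set s;
  simplex_nonempty : forall s, simplex s -> s !=set0;
  simplex_face : forall s t, simplex s -> t `<=` s -> t !=set0 -> simplex t }.

Definition face (V : Type) (i : nat) (v : seq V) := take i v ++ drop i.+1 v.
Arguments face : simpl never.

Section Chains.
Variables (V : choiceType) (G : zmodType).
Implicit Types (K L : simplicial_complex V) (n : int) (c d : seq V -> G).

(* A vertex sequence v without repetitions stands for the oriented simplex
   [v_0, ..., v_n]. *)
Definition ordering K n (v : seq V) : Prop :=
  [/\ uniq v, (size v)%:Z = n + 1 & simplex K [set` v]].

Definition alternating c : Prop := forall r x s y t,
  c (r ++ x :: s ++ y :: t) = - c (r ++ y :: s ++ x :: t).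

(* An oriented chain with coefficients in G is an alternating, finitely
   supported function on the orderings of the n-simplices: the generator
   g [v_0, ..., v_n] is the function with value g on the even and - g on the odd
   rearrangements of v. *)
Definition chain K n c : Prop :=
  [/\ forall v, c v != 0 -> ordering K n v,
      alternating c & finite_set [set v | c v != 0]].

(* The coefficient of [w] in the boundary: w is the 0-th face of x :: w, so it
   occurs with sign + in the boundary of [x :: w]. There is no augmentation:
   0-chains have boundary 0. *)
Definition boundary c (w : seq V) : G :=
  if w is [::] then 0 else \sum_(x \in [set: V]) c (x :: w).

(* With C_n(K, L) = C_n(K) / C_n(L), the group H_n(K, L) is the quotient of
   {c in C_n(K) | boundary c in C_(n-1)(L)} by boundary(C_(n+1)(K)) + C_n(L). *)
Definition relative_cycle K L n : {pred (seq V -> G)} := fun c =>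
  `[< chain K n c /\ chain L (n - 1) (boundary c) >].

Definition relative_boundary K L n : {pred (seq V -> G)} := fun c =>
  `[< exists d e, [/\ chain K (n + 1) d, chain L n e & c = boundary d + e] >].

(* Hom(C_n(K, L), G), seen as functions on orderings of n-simplices *)
Definition cochain K L n c : Prop :=
  [/\ forall v, c v != 0 -> ordering K n v,
      forall v, ordering L n v -> c v = 0 & alternating c].

Definition coboundary K c (v : seq V) : G :=
  if `[< uniq v /\ simplex K [set` v] >]
  then \sum_(i < size v) c (face i v) *~ (-1) ^+ i else 0.

Definition relative_cocycle K L n : {pred (seq V -> G)} := fun c =>
  `[< cochain K L n c /\ coboundary K c = 0 >].

Definition relative_coboundary K L n : {pred (seq V -> G)} := fun c =>
  `[< exists2 d, cochain K L (n - 1) d & c = coboundary K d >].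

Lemma alternatingB c d : alternating c -> alternating d -> alternating (c - d).
Proof. by move=> ca da r x s y t; rewrite !fctE ca da opprD. Qed.

Lemma chain0 K n : chain K n 0.
Proof.
split=> [v|r x s y t|]; [by rewrite eqxx|by rewrite oppr0|].
by rewrite (_ : mkset _ = set0)//; apply/seteqP; split=> v //=; rewrite eqxx.
Qed.

Lemma chainB K n c d : chain K n c -> chain K n d -> chain K n (c - d).
Proof.
move=> [cK ca cf] [dK da df]; split.
- by move=> v /subr_neq0P[]; [exact: cK|exact: dK].
- exact: alternatingB.
- exact: finite_suppB.
Qed.

Lemma chain_nil K n c : chain K n c -> c [::] = 0.
Proof.
move=> [cK _ _]; apply/eqP/negP => /negP /cK[_ _ /simplex_nonempty[x]].
by rewrite /= in_nil.
Qed.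

Lemma boundary0 : boundary 0 = 0.
Proof. by apply/funext => -[|x w] //=; rewrite fsbig1. Qed.

Lemma boundaryB c d : finite_set [set v | c v != 0] ->
  finite_set [set v | d v != 0] -> boundary (c - d) = boundary c - boundary d.
Proof.
move=> cf df; apply/funext => -[|y w]; first by rewrite !fctE /= subrr.
have finc (b : seq V -> G) : finite_set [set v | b v != 0] ->
    finite_set [set x | b (x :: y :: w) != 0].
  move=> bf; apply: (@finite_preimage _ _ _ (fun x => x :: y :: w)) bf.
  by move=> x x' _ _ [].
rewrite !fctE /boundary -fsumB; [by []|exact: finc|exact: finc].
Qed.

Fact relative_cycle_closed K L n : zmod_closed (relative_cycle K L n).
Proof.
split; first by apply/asboolP; rewrite boundary0; split; exact: chain0.
move=> c d /asboolP[cK cL] /asboolP[dK dL]; apply/asboolP; split.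
  exact: chainB.
by rewrite boundaryB; [exact: chainB| case: cK|case: dK].
Qed.

Fact relative_boundary_closed K L n : zmod_closed (relative_boundary K L n).
Proof.
split.
  by apply/asboolP; exists 0, 0; rewrite boundary0 addr0; split=> //; exact: chain0.
move=> c d /asboolP[c1 [c2 [c1K c2L ->]]] /asboolP[d1 [d2 [d1K d2L ->]]].
apply/asboolP; exists (c1 - d1), (c2 - d2); split; [exact: chainB..|].
rewrite boundaryB; [|by case: c1K|by case: d1K].
by rewrite opprD addrACA.
Qed.

Lemma cochain0 K L n : cochain K L n 0.
Proof. by split=> [v|//|r x s y t]; [rewrite eqxx|rewrite oppr0]. Qed.

Lemma cochainB K L n c d :
  cochain K L n c -> cochain K L n d -> cochain K L n (c - d).
Proof.
move=> [cK cL ca] [dK dL da]; split.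
- by move=> v /subr_neq0P[]; [exact: cK|exact: dK].
- by move=> v vL; rewrite !fctE cL// dL// subrr.
- exact: alternatingB.
Qed.

Lemma coboundary0 K : coboundary K 0 = 0.
Proof.
apply/funext => v; rewrite /coboundary; case: ifP => // _.
by rewrite big1// => i _; rewrite mul0rz.
Qed.

Lemma coboundaryB K c d : coboundary K (c - d) = coboundary K c - coboundary K d.
Proof.
apply/funext => v; rewrite !fctE /coboundary; case: ifP => _; last by rewrite subrr.
by rewrite -sumrB; apply: eq_bigr => i _; rewrite mulrzBl.
Qed.

Fact relative_cocycle_closed K L n : zmod_closed (relative_cocycle K L n).
Proof.
split; first by apply/asboolP; rewrite coboundary0; split=> //; exact: cochain0.
move=> c d /asboolP[cK c0] /asboolP[dK d0]; apply/asboolP; split.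
  exact: cochainB.
by rewrite coboundaryB c0 d0 subrr.
Qed.

Fact relative_coboundary_closed K L n : zmod_closed (relative_coboundary K L n).
Proof.
split.
  by apply/asboolP; exists 0; rewrite ?coboundary0//; exact: cochain0.
move=> _ _ /asboolP[c cK ->] /asboolP[d dK ->]; apply/asboolP.
by exists (c - d); [exact: cochainB|rewrite coboundaryB].
Qed.

HB.instance Definition _ K L n := GRing.isZmodClosed.Build (seq V -> G)
  (relative_cycle K L n) (relative_cycle_closed K L n).
HB.instance Definition _ K L n := GRing.isZmodClosed.Build (seq V -> G)
  (relative_boundary K L n) (relative_boundary_closed K L n).
HB.instance Definition _ K L n := GRing.isZmodClosed.Build (seq V -> G)
  (relative_cocycle K L n) (relative_cocycle_closed K L n).
HB.instance Definition _ K L n := GRing.isZmodClosed.Build (seq V -> G)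
  (relative_coboundary K L n) (relative_coboundary_closed K L n).

Definition homology K L n : zmodType :=
  subquotient (relative_cycle K L n) (relative_boundary K L n).

Definition cohomology K L n : zmodType :=
  subquotient (relative_cocycle K L n) (relative_coboundary K L n).

End Chains.

Section Alternating.
Variables (V : choiceType) (G : zmodType).
Implicit Types (c : seq V -> G).

Definition swap (i m : nat) (u : seq V) : seq V :=
  if drop i u is a :: u' then
    if drop m u' is b :: t then take i u ++ b :: take m u' ++ a :: t else u
  else u.

Lemma swap_cat r x s y t :
  swap (size r) (size s) (r ++ x :: s ++ y :: t) = r ++ y :: s ++ x :: t.
Proof. by rewrite /swap drop_size_cat// drop_size_cat// !take_size_cat. Qed.

Lemma swapP i m u : swap i m u = u \/
  exists r x s y t, [/\ size r = i, size s = m & u = r ++ x :: s ++ y :: t].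
Proof.
rewrite /swap; case E: (drop i u) => [|a u']; first by left.
case E' : (drop m u') => [|b t]; first by left.
right; exists (take i u), a, (take m u'), b, t.
rewrite -E' cat_take_drop -E cat_take_drop; split=> //.
  by rewrite size_takel// ltnW// -subn_gt0 -size_drop E.
by rewrite size_takel// ltnW// -subn_gt0 -size_drop E'.
Qed.

Lemma swapK i m : involutive (swap i m).
Proof.
move=> u; have [e|[r [x [s [y [t [ri sm ->]]]]]]] := swapP i m u.
  by rewrite !e.
by rewrite -{}ri -{}sm !swap_cat.
Qed.


Lemma alternating_swap c i m u : alternating c ->
  (i + m.+1 < size u)%N -> c (swap i m u) = - c u.
Proof.
move=> ca imu; rewrite /swap.
have i_u : (i < size u)%N by apply: leq_ltn_trans imu; exact: leq_addr.
case E: (drop i u) => [|a u'].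
  by move: i_u; rewrite -subn_gt0 -size_drop E.
have mu' : (m < size u')%N.
  move: imu; rewrite -ltn_subRL -size_drop E /=.
  by rewrite ltnS.
case E' : (drop m u') => [|b t].
  by move: mu'; rewrite -subn_gt0 -size_drop E'.
by rewrite ca -E' cat_take_drop -E cat_take_drop.
Qed.

Lemma not_uniqP (v : seq V) : ~~ uniq v ->
  exists r x s t, v = r ++ x :: s ++ x :: t.
Proof.
elim: v => //= x v IH; rewrite negb_and negbK => /orP[xv|/IH[r [y [s [t ->]]]]].
  case/splitPr: xv => s t; by exists [::], x, s, t.
by exists (x :: r), y, s, t.
Qed.

End Alternating.

Section Pushforward.
Variables (V' V : choiceType) (G : zmodType) (f : V' -> V).
Implicit Types (c : seq V' -> G).

Lemma map_catP (u : seq V') r x s y t : map f u = r ++ x :: s ++ y :: t ->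
  exists r' x' s' y' t', u = r' ++ x' :: s' ++ y' :: t' /\
    [/\ map f r' = r, f x' = x, map f s' = s, f y' = y & map f t' = t].
Proof.
move=> h; exists (take (size r) u).
have : drop (size r) (map f u) = x :: s ++ y :: t by rewrite h drop_size_cat.
rewrite -map_drop; case E: (drop (size r) u) => [//|x' u'] /= [fx fu'].
have : drop (size s) (map f u') = y :: t by rewrite fu' drop_size_cat.
rewrite -map_drop; case E': (drop (size s) u') => [//|y' t'] /= [fy ft'].
exists x', (take (size s) u'), y', t'.
by rewrite -E' cat_take_drop -E cat_take_drop !map_take h fu' !take_size_cat.
Qed.

(* The chain map sending [v] to [f v], or to 0 when f v has a repetition *)
Definition pushforward c (w : seq V) : G :=
  if uniq w then \sum_(v \in [set v | map f v = w]) c v else 0.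

Lemma pushforwardE c : alternating c -> finite_set [set v | c v != 0] ->
  (forall v, c v != 0 -> uniq v) ->
  pushforward c = fun w => \sum_(v \in [set v | map f v = w]) c v.
Proof.
move=> ca cf cu; apply/funext => w; rewrite /pushforward; case: ifPn => // wu.
have [r [x [s [t wE]]]] := not_uniqP wu.
apply/esym/(@fsum_involution _ _ _ (swap (size r) (size s))) => //.
- move=> u; rewrite wE => /map_catP[r' [x' [s' [y' [t' [-> [<- fx <- fy <-]]]]]]] /=.
  by rewrite !size_map swap_cat map_cat /= map_cat /= fx fy.
- move=> u; rewrite wE => /map_catP[r' [x' [s' [y' [t' [-> [<- _ <- _ _]]]]]]] /=.
  rewrite !size_map swap_cat => /cu.
  rewrite cat_uniq /= mem_cat inE !negb_or => /and4P[_ _ /and3P[_ xy _] _].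
  rewrite eqseq_cat// eqxx /= eqseq_cons negb_and eq_sym xy//.
- exact: swapK.
- move=> u; rewrite wE => /map_catP[r' [x' [s' [y' [t' [-> [<- _ <- _ _]]]]]]] /=.
  by rewrite !size_map swap_cat ca.
Qed.

Lemma pushforward_neq0 c w : pushforward c w != 0 ->
  uniq w /\ exists2 v, map f v = w & c v != 0.
Proof.
rewrite /pushforward; case: ifP => [wu|]; last by rewrite eqxx.
by move=> /fsum_neq0[v /= fv cv]; split=> //; exists v.
Qed.

Lemma pushforward_supp c : finite_set [set v | c v != 0] ->
  finite_set [set w | pushforward c w != 0].
Proof.
move=> cf; apply: (@sub_finite_set _ _ (map f @` [set v | c v != 0])).
  by move=> w /= /pushforward_neq0[_ [v fv cv]]; exists v.
exact: finite_image.
Qed.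

Lemma pushforward_alternating c : alternating c ->
  finite_set [set v | c v != 0] -> alternating (pushforward c).
Proof.
move=> ca cf r x s y t; rewrite /pushforward.
set w := _ ++ _; set w' := r ++ y :: _.
have ww' : swap (size r) (size s) w = w' by rewrite swap_cat.
have fsw u : map f (swap (size r) (size s) u) = swap (size r) (size s) (map f u).
  rewrite /swap -map_drop; case: drop => //= a u'; rewrite -map_drop.
  by case: drop => //= b u''; rewrite map_cat /= map_cat /= !map_take.
have -> : uniq w' = uniq w.
  apply: perm_uniq; rewrite /w /w' perm_cat2l; apply/permP => p.
  rewrite /= !count_cat /= [in LHS](addnCA (count p s)) addnCA.
  by rewrite [in RHS](addnCA (count p s)).
case: ifP => wu; last by rewrite oppr0.
rewrite -fsumN//.
rewrite (@reindex_fsbig _ _ _ _ _ (swap (size r) (size s)) [set v | map f v = w']).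
  apply: eq_fsbigr => u /set_mem /= fu; rewrite alternating_swap//.
  rewrite -(size_map f) fu /w' !size_cat /= size_cat /=.
  by rewrite ltn_add2l ltnS addnS ltnS leq_addr.
split.
- by move=> u /= fu; rewrite fsw fu /w' swap_cat.
- by move=> u v _ _; exact: (can_inj (swapK _ _)).
- move=> u /= fu; exists (swap (size r) (size s) u); last exact: swapK.
  by rewrite /= fsw fu ww'.
Qed.

Lemma pushforwardB c d : finite_set [set v | c v != 0] ->
  finite_set [set v | d v != 0] ->
  pushforward (c - d) = pushforward c - pushforward d.
Proof.
move=> cf df; apply/funext => w; rewrite !fctE /pushforward.
by case: ifP => _; [rewrite -fsumB|rewrite subrr].
Qed.

Lemma pushforwardD c d : finite_set [set v | c v != 0] ->
  finite_set [set v | d v != 0] ->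
  pushforward (c + d) = pushforward c + pushforward d.
Proof.
move=> cf df.
have Nf : finite_set [set v | (- d) v != 0].
  rewrite (_ : mkset _ = [set v | d v != 0])//; apply/seteqP.
  by split=> v /=; rewrite !fctE oppr_eq0.
have cdf : finite_set [set v | (c + d) v != 0].
  by rewrite -[d]opprK; exact: finite_suppB.
by rewrite -[c in RHS](addrK d) pushforwardB// subrK.
Qed.

Variables (K' : simplicial_complex V') (K : simplicial_complex V).
Hypothesis fK : forall s, simplex K' s -> simplex K (f @` s).

Lemma simplex_map v : simplex K' [set` v] -> simplex K [set` map f v].
Proof.
move=> /fK; congr (simplex K _); apply/seteqP; split => [y [x xv <-]|y] /=.
  exact: map_f.
by move=> /mapP[x xv ->]; exists x.
Qed.

Lemma pushforward_chain n c : chain K' n c -> chain K n (pushforward c).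
Proof.
move=> [cK ca cf]; split.
- move=> w /pushforward_neq0[wu [v fv /cK[_ sv Kv]]]; split=> //.
    by rewrite -fv size_map.
  by rewrite -fv; exact: simplex_map.
- exact: pushforward_alternating.
- exact: pushforward_supp.
Qed.

Lemma boundaryE (W : choiceType) (c : seq W -> G) (w : seq W) : w != [::] ->
  boundary c w = \sum_(u \in [set u | u != [::]] `&` behead @^-1` [set w]) c u.
Proof.
case: w => // y w _; rewrite /boundary.
rewrite -(@fsbig_image _ _ _ _ _ [set: W] (fun x => x :: y :: w)); last first.
  by move=> x x' _ _ [].
apply: eq_fsbigl; apply/seteqP; split=> [u [x _ <-]//|[|x u] []//= _ <-].
by exists x.
Qed.

Lemma boundary_supp (W : choiceType) (c : seq W -> G) :
  finite_set [set v | c v != 0] -> finite_set [set v | boundary c v != 0].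
Proof.
move=> cf; apply: (@sub_finite_set _ _ (behead @` [set v | c v != 0])).
  move=> [|y w] /=; first by rewrite eqxx.
  by move=> /fsum_neq0[x _ cx]; exists (x :: y :: w).
exact: finite_image.
Qed.

Lemma boundary_uniq n (W : choiceType) (M : simplicial_complex W)
  (c : seq W -> G) v : chain M n c -> boundary c v != 0 -> uniq v.
Proof.
case: v => [|y w] [cK _ _] /=; first by rewrite eqxx.
by move=> /fsum_neq0[x _ /cK[/=/andP[]]].
Qed.

Lemma boundary_alternating (W : choiceType) (c : seq W -> G) :
  alternating c -> finite_set [set v | c v != 0] -> alternating (boundary c).
Proof.
move=> ca cf r x s y t.
have E z1 z2 : boundary c (r ++ z1 :: s ++ z2 :: t) =
    \sum_(z \in [set: W]) c ((z :: r) ++ z1 :: s ++ z2 :: t).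
  by case: (r).
rewrite !E -fsumN; first by apply: eq_fsbigr => z _; rewrite ca.
apply: (@finite_preimage _ _ _ (fun z => (z :: r) ++ y :: s ++ x :: t)) cf.
by move=> z z' _ _ [].
Qed.

Lemma boundary_pushforward n c : chain K' n c ->
  boundary (pushforward c) = pushforward (boundary c).
Proof.
move=> cK; have [cO ca cf] := cK.
rewrite pushforwardE//; last by move=> v /cO[].
rewrite pushforwardE; first last.
- by move=> v; exact: boundary_uniq cK.
- exact: boundary_supp.
- exact: boundary_alternating.
apply/funext => w.
have [->|w0] := eqVneq w [::].
  rewrite /= fsbig1// => v /=.
  by case: v.
rewrite boundaryE//.
transitivity (\sum_(z \in [set u | u != [::]] `&` behead @^-1` [set w])
    \sum_(u \in setT `&` map f @^-1` [set z]) c u).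
  by apply: eq_fsbigr => z _; rewrite setTI.
transitivity (\sum_(v \in [set v | map f v = w])
    \sum_(u \in [set u | u != [::]] `&` behead @^-1` [set v]) c u); last first.
  apply: eq_fsbigr => v /set_mem /= fv; rewrite boundaryE//.
  by apply: contraNneq w0 => v0; rewrite -fv v0.
rewrite (fsum_fibre _ _ _ cf) (fsum_fibre _ _ _ cf) setTI.
apply: eq_fsbigl; apply/seteqP; split=> -[|x u] [] //=.
Qed.

End Pushforward.

Section Pullback.
Variables (V' V : choiceType) (G : zmodType) (f : V' -> V).
Implicit Types (c : seq V -> G).

Definition pullback (K' : simplicial_complex V') c (v : seq V') : G :=
  if `[< uniq v /\ simplex K' [set` v] >] then c (map f v) else 0.

Lemma face_map (W W' : Type) (h : W -> W') i (v : seq W) :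
  face i (map h v) = map h (face i v).
Proof. by rewrite /face map_cat map_take map_drop. Qed.

Lemma face_cons (W : Type) i (x : W) v : face i.+1 (x :: v) = x :: face i v.
Proof. by []. Qed.

Lemma face0 (W : Type) (x : W) v : face 0 (x :: v) = v.
Proof. by rewrite /face /= drop0. Qed.

Lemma face_cat (W : Type) i (r t : seq W) :
  face i (r ++ t) =
  if (i < size r)%N then face i r ++ t else r ++ face (i - size r) t.
Proof.
elim: r i => [|x r IH] i; first by rewrite subn0.
case: i => [|i]; first by rewrite cat_cons !face0.
by rewrite cat_cons !face_cons IH /= ltnS subSS; case: ifP.
Qed.

Lemma mem_face (W : eqType) i (v : seq W) x : x \in face i v -> x \in v.
Proof. by rewrite mem_cat => /orP[/mem_take|/mem_drop]. Qed.

Lemma uniq_face (W : eqType) i (v : seq W) : uniq v -> uniq (face i v).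
Proof.
elim: v i => [|x v IH] [|i] //; first by rewrite face0 => /= /andP[].
rewrite face_cons /= => /andP[xv /IH->]; rewrite andbT.
by apply: contra xv; exact: mem_face.
Qed.

Lemma alternating_move c r s x t : alternating c ->
  c (r ++ s ++ x :: t) = c (r ++ x :: s ++ t) *~ (-1) ^+ size s.
Proof.
move=> ca; elim: s r => [|y s IH] r /=; first by rewrite expr0.
have := IH (rcons r y); rewrite !cat_rcons => ->.
have := ca r y [::] x (s ++ t); rewrite /= => ->.
by rewrite exprS mulN1r mulrNz mulNrz.
Qed.

Lemma alternating_repeated c w : alternating c -> (forall v, c v != 0 -> uniq v) ->
  ~~ uniq w -> \sum_(i < size w) c (face i w) *~ (-1) ^+ i = 0.
Proof.
move=> ca cu /not_uniqP[r [x [s [t wE]]]].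
have c0 v : ~~ uniq v -> c v = 0.
  by move=> vu; apply/eqP; apply: contraNT vu; exact: cu.
have rep r' s' t' y : ~~ uniq (r' ++ y :: s' ++ y :: t').
  by rewrite cat_uniq /= mem_cat inE eqxx !orbT /= !andbF.
have i1w : (size r < size w)%N.
  by rewrite wE size_cat /= addnS ltnS leq_addr.
have i2w : (size r + (size s).+1 < size w)%N.
  by rewrite wE size_cat /= size_cat /= ltn_add2l ltnS addnS ltnS leq_addr.
rewrite (bigD1 (Ordinal i1w))//= (bigD1 (Ordinal i2w))/=; last first.
  by rewrite -val_eqE /= addnS gtn_eqF// ltnS leq_addr.
rewrite [X in _ + (_ + X)]big1 ?addr0; last first.
  move=> [i iw] /=; rewrite -!val_eqE /= => /andP[i1 i2].
  rewrite c0 ?mul0rz// wE face_cat; case: ltnP => [//|ri].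
  have := subnKC ri; case: (i - size r)%N => [|j] ij.
    by move: i1; rewrite -ij addn0 eqxx.
  rewrite face_cons face_cat; case: ltnP => [//|sj].
  have := subnKC sj; case: (j - size s)%N => [|k] jk.
    by move: i2; rewrite -ij -jk addn0 eqxx.
  by rewrite face_cons.
have -> : face (size r) w = r ++ s ++ x :: t.
  by rewrite wE face_cat ltnn subnn face0.
have -> : face (size r + (size s).+1) w = r ++ x :: s ++ t.
  rewrite wE face_cat ltnNge leq_addr /= addKn face_cons face_cat ltnn subnn.
  by rewrite face0.
rewrite alternating_move// -mulrzA -mulrzDr; apply/eqP.
rewrite addnS exprS exprD mulN1r [X in X - _]mulrC subrr mulr0z//.
Qed.

Section PullbackMap.
Variables (K' L' : simplicial_complex V') (K L : simplicial_complex V).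
Hypothesis fK : forall s, simplex K' s -> simplex K (f @` s).
Hypothesis fL : forall s, simplex L' s -> simplex L (f @` s).

Lemma pullback_cochain n c : cochain K L n c -> cochain K' L' n (pullback K' c).
Proof.
move=> [cK cL ca]; split.
- move=> v; rewrite /pullback; case: asboolP => [[vu Kv]|]; last by rewrite eqxx.
  by move=> /cK[_ sv _]; split=> //; rewrite -(size_map f).
- move=> v [vu sv Lv]; rewrite /pullback; case: asboolP => // _.
  have [fu|nfu] := boolP (uniq (map f v)).
    by apply: cL; split; [|rewrite size_map|exact: simplex_map Lv].
  by apply/eqP; apply: contraNT nfu => /cK[].
- move=> r x s y t; rewrite /pullback.
  set w := r ++ x :: _; set w' := r ++ y :: _.
  have ww' : perm_eq w w'.
    rewrite /w /w' perm_cat2l; apply/permP => p.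
    rewrite /= !count_cat /= [in LHS](addnCA (count p s)) addnCA.
    by rewrite [in RHS](addnCA (count p s)).
  have -> : [set` w] = [set` w'].
    by apply/seteqP; split=> z /=; rewrite (perm_mem ww').
  rewrite (perm_uniq ww'); case: ifP => _; last by rewrite oppr0.
  by rewrite /w /w' !map_cat /= !map_cat ca.
Qed.

Lemma coboundary_pullback n c : cochain K L n c ->
  coboundary K' (pullback K' c) = pullback K' (coboundary K c).
Proof.
move=> [cK cL ca]; apply/funext => v; rewrite /coboundary {2}/pullback.
case: asboolP => // -[vu Kv].
have c0 u : ~ simplex K [set` u] -> c u = 0.
  by move=> Ku; apply/eqP/negP => /negP /cK[].
have facev (i : 'I_(size v)) : pullback K' c (face i v) = c (face i (map f v)).
  rewrite /pullback face_map; case: asboolP => // h.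
  have [e|ne] := eqVneq (face i v) [::].
    by rewrite e c0// => /simplex_nonempty[z]; rewrite /= in_nil.
  exfalso; apply: h; split; first exact: uniq_face.
  apply: simplex_face Kv _ _; first by move=> z; exact: mem_face.
  by case: (face i v) ne => // z l _; exists z; rewrite /= inE eqxx.
under eq_bigr do rewrite facev.
have Kfv := simplex_map fK Kv.
case: asboolP => [_|h]; first by rewrite size_map.
rewrite -(size_map f) alternating_repeated//; first by move=> u /cK[].
by apply/negP => fu; apply: h.
Qed.

End PullbackMap.

Lemma pullbackB (K' : simplicial_complex V') c d : pullback K' (c - d) = pullback K' c - pullback K' d.
Proof.
by apply/funext => v; rewrite !fctE /pullback; case: ifP => //; rewrite subrr.
Qed.

End Pullback.

Record simplicial_map (V' V : Type) (K' L' : simplicial_complex V')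
    (K L : simplicial_complex V) := SimplicialMap {
  vertex_map :> V' -> V;
  simplicial_mapK : forall s, simplex K' s -> simplex K (vertex_map @` s);
  simplicial_mapL : forall s, simplex L' s -> simplex L (vertex_map @` s) }.

Section InducedMaps.
Variables (V' V : choiceType) (G : zmodType).
Variables (K' L' : simplicial_complex V') (K L : simplicial_complex V).
Variables (f : simplicial_map K' L' K L) (n : int).

Fact pushforward_cycle (c : seq V' -> G) :
  c \in relative_cycle K' L' n -> pushforward f c \in relative_cycle K L n.
Proof.
move=> /asboolP[cK cL]; apply/asboolP; split.
  exact: pushforward_chain (simplicial_mapK f) _ _ cK.
rewrite (boundary_pushforward _ cK).
exact: pushforward_chain (simplicial_mapL f) _ _ cL.
Qed.

Fact pushforward_boundary (c : seq V' -> G) : c \in relative_cycle K' L' n ->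
  c \in relative_boundary K' L' n ->
  pushforward f c \in relative_boundary K L n.
Proof.
move=> _ /asboolP[d [e [dK eL ->]]]; apply/asboolP.
exists (pushforward f d), (pushforward f e); split.
- exact: pushforward_chain (simplicial_mapK f) _ _ dK.
- exact: pushforward_chain (simplicial_mapL f) _ _ eL.
rewrite (boundary_pushforward _ dK) pushforwardD//; last by case: eL.
by apply: boundary_supp; case: dK.
Qed.

Fact pushforward_cycleB : {in relative_cycle K' L' n &,
  {morph (pushforward f : (seq V' -> G) -> _) : c d / c - d}}.
Proof.
move=> c d /asboolP[[_ _ cf] _] /asboolP[[_ _ df] _].
by rewrite pushforwardB.
Qed.

Definition homology_map : {additive homology G K' L' n -> homology G K L n} :=
  subquotient_morphism pushforward_cycle pushforward_boundary pushforward_cycleB.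

Fact pullback_cocycle (c : seq V -> G) : c \in relative_cocycle K L n ->
  pullback f K' c \in relative_cocycle K' L' n.
Proof.
move=> /asboolP[cK c0]; apply/asboolP; split.
  exact: (pullback_cochain K' (simplicial_mapL f) cK).
rewrite (coboundary_pullback (simplicial_mapK f) cK) c0.
by apply/funext => v; rewrite /pullback; case: ifP.
Qed.

Fact pullback_coboundary (c : seq V -> G) : c \in relative_cocycle K L n ->
  c \in relative_coboundary K L n ->
  pullback f K' c \in relative_coboundary K' L' n.
Proof.
move=> _ /asboolP[d dK ->]; apply/asboolP; exists (pullback f K' d).
  exact: (pullback_cochain K' (simplicial_mapL f) dK).
by rewrite (coboundary_pullback (simplicial_mapK f) dK).
Qed.

Fact pullback_cocycleB : {in relative_cocycle K L n &,
  {morph (pullback f K' : (seq V -> G) -> _) : c d / c - d}}.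
Proof. by move=> c d _ _; exact: pullbackB. Qed.

Definition cohomology_map :
    {additive cohomology G K L n -> cohomology G K' L' n} :=
  subquotient_morphism pullback_cocycle pullback_coboundary pullback_cocycleB.

End InducedMaps.

(* The index types range over a fixed universe. The limits below are groups of
   functions on sets of families, so this universe lies strictly below the one
   of the carriers of groups and spaces. It contains all finite types, and finite
   covers are cofinal among the open covers of a compact space. *)
Record indexed_family (X : Type) :=
  IndexedFamily { idx : Type; member :> idx -> set X }.

Definition covers (X : Type) (a : indexed_family X) : Prop :=
  forall x, exists v : idx a, a v x.

Record refinement (X : Type) (b a : indexed_family X) := Refinement {
  projection :> idx b -> idx a;
  projection_sub : forall v, b v `<=` a (projection v) }.

(* {classic _} only provides the index type with a choiceType structure. *)
Section Nerve.
Variables (X : Type).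
Implicit Types (a b : indexed_family X) (A : set X).

Definition nerve_simplex A a (s : set {classic idx a}) : Prop :=
  [/\ finite_set s, s !=set0 & A `&` \bigcap_(v in s) a v !=set0].

Fact nerve_face A a s t : nerve_simplex A s -> t `<=` s -> t !=set0 ->
  @nerve_simplex A a t.
Proof.
move=> [sf _ [x [Ax sx]]] ts t0; split=> //; first exact: sub_finite_set sf.
by exists x; split=> // v /ts; exact: sx.
Qed.

Definition subnerve A a : simplicial_complex {classic idx a} :=
  @SimplicialComplex _ (@nerve_simplex A a)
    (fun s h => let: And3 f _ _ := h in f) (fun s h => let: And3 _ e _ := h in e)
    (@nerve_face A a).

Definition nerve a := subnerve [set: X] a.

Fact refinement_simplex A b a (p : refinement b a) (s : set {classic idx b}) :
  simplex (subnerve A b) s -> simplex (subnerve A a) (p @` s).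
Proof.
move=> [sf [v sv] [x [Ax sx]]]; split; first exact: finite_image.
  by exists (p v); exists v.
exists x; split=> // _ [u su <-]; apply: (@projection_sub _ _ _ p); exact: sx.
Qed.

Definition refinement_map A b a (p : refinement b a) :
    simplicial_map (nerve b) (subnerve A b) (nerve a) (subnerve A a) :=
  @SimplicialMap {classic idx b} {classic idx a} _ _ _ _ p
    (@refinement_simplex _ _ _ p) (@refinement_simplex _ _ _ p).

End Nerve.

(* Every refinement projection is an arrow of the system: all projections
   between two given covers induce the same map on (co)homology. *)
Section Limits.
Variables (X : Type) (cov : set (indexed_family X)) (A : set X).
Variables (G : zmodType) (n : int).

Definition cover_index : Type := {a : indexed_family X | cov a}.

Definition limit_homology : zmodType :=
  @inverse_limit cover_index
    (fun a => homology G (nerve (sval a)) (subnerve A (sval a)) n)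
    (fun b a => refinement (sval b) (sval a))
    (fun b a p => homology_map G (refinement_map A p) n).

Definition limit_cohomology : zmodType :=
  @direct_limit cover_index
    (fun a => cohomology G (nerve (sval a)) (subnerve A (sval a)) n)
    (fun a b => refinement (sval b) (sval a))
    (fun a b p => cohomology_map G (refinement_map A p) n).

End Limits.

Definition functionally_open (R : realType) (X : topologicalType) (U : set X) :=
  exists f : X -> R, [/\ continuous f, forall x, f x \in `[0, 1] &
    U = f @^-1` `]0, 1]].

Definition completely_closed (R : realType) (X : topologicalType) (A : set X) :=
  closed A /\ forall f : X -> R, {within A, continuous f} ->
    (forall x, A x -> f x \in `[0, 1]) ->
    exists g : X -> R, [/\ continuous g, forall x, g x \in `[0, 1] &
      forall x, A x -> g x = f x].

Definition functional_covers (R : realType) (X : topologicalType) :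
    set (indexed_family X) :=
  [set a | [/\ finite_set [set: idx a], covers a &
               forall v, functionally_open R (a v)]].

Definition open_covers (X : topologicalType) : set (indexed_family X) :=
  [set a | covers a /\ forall v, open (a v)].

Arguments functional_covers : clear implicits.
Arguments open_covers : clear implicits.

Definition cech_homology (X : topologicalType) (A : set X) (G : zmodType)
  (n : int) : zmodType := limit_homology (open_covers X) A G n.

Definition cech_cohomology (X : topologicalType) (A : set X) (G : zmodType)
  (n : int) : zmodType := limit_cohomology (open_covers X) A G n.

Definition functional_homology (R : realType) (X : topologicalType)
  (A : set X) (G : zmodType) (n : int) : zmodType :=
  limit_homology (functional_covers R X) A G n.

Definition functional_cohomology (R : realType) (X : topologicalType)
  (A : set X) (G : zmodType) (n : int) : zmodType :=
  limit_cohomology (functional_covers R X) A G n.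

Definition tychonoff_space (X : topologicalType) : Prop :=
  completely_regular_space X /\ hausdorff_space X.

(* i : X -> B is a Stone-Cech compactification of X: a Hausdorff
   compactification to which every continuous map from X to a compact Hausdorff
   space extends (uniquely, since the image of X is dense). *)
Record stone_cech (X B : topologicalType) (i : X -> B) : Prop := StoneCech {
  stone_cech_compact : compact [set: B];
  stone_cech_hausdorff : hausdorff_space B;
  stone_cech_injective : injective i;
  stone_cech_open : forall U : set X,
    open U <-> exists2 W : set B, open W & U = i @^-1` W;
  stone_cech_dense : dense (range i);
  stone_cech_extension : forall (T : topologicalType) (f : X -> T),
    compact [set: T] -> hausdorff_space T -> continuous f ->
    exists2 g : B -> T, continuous g & g \o i = f }.

(* Main.v *)
(** For [U] open in [X] let [open_extension U] be the complement of the closure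
    of [X \ U] in [beta X]: the largest open set with trace [U] on [X]. Applied
    to the members of a finite functionally open cover of [X] it gives an open
    cover of [beta X], by extending a subordinate partition of unity, and as [X]
    is dense the nerve pair of the new cover for the closure of [A] is exactly
    that of the old cover for [A]. This is a functor on covers and refinements,
    and by Urysohn's lemma the covers so obtained refine every open cover of
    [beta X]. Two refinements of the same open cover by extended covers both
    factor through the disjoint union of these covers, so the functor is final
    and the limits agree; in particular no contiguity argument is needed for the
    independence of the chosen projections. *)
From HB Require Import structures.
From mathcomp Require Import all_boot all_order all_algebra.
From mathcomp Require Import all_classical all_reals all_analysis.
From mathcomp Require Import lra.
Require Import Defs.

Set Implicit Arguments.
Unset Strict Implicit.
Unset Printing Implicit Defensive.

Import Order.TTheory GRing.Theory Num.Theory.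
Import numFieldNormedType.Exports.

Local Open Scope classical_set_scope.
Local Open Scope ring_scope.

(** * Final functors and limits of abelian groups *)

Lemma isomorphic_sym (U V : zmodType) : isomorphic U V -> isomorphic V U.
Proof.
move=> [f [g fK gK]].
have gB : zmod_morphism g by move=> x y; apply: (can_inj fK); rewrite raddfB !gK.
pose g' : {additive V -> U} :=
  HB.pack g (GRing.isZmodMorphism.Build V U g gB).
by exists g', f.
Qed.

Lemma isomorphic_trans (U V W : zmodType) :
  isomorphic U V -> isomorphic V W -> isomorphic U W.
Proof.
by move=> [f bf] [g bg]; exists (g \o f : {additive U -> W}); exact: bij_comp.
Qed.

Lemma isomorphic_congr (U V M : zmodType) :
  isomorphic U V -> isomorphic U M <-> isomorphic V M.
Proof.
move=> UV; split; first exact/isomorphic_trans/isomorphic_sym.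
exact: isomorphic_trans.
Qed.

(** * The universal property of the direct limit *)

Section DirectLimit.
Variables (I : Type) (H : I -> zmodType) (Arr : I -> I -> Type).
Variable tr : forall i i', Arr i i' -> {additive H i -> H i'}.
Implicit Types (x y : product H).

Lemma single_eq i (a : H i) : single a i = a.
Proof. exact: (@dfwithin {classic I} (fun i : {classic I} => H i)). Qed.

Lemma single_neq i (a : H i) k : i <> k -> single a k = 0.
Proof.
move=> ik; apply: (@dfwithout {classic I} (fun i : {classic I} => H i)).
exact/eqP.
Qed.

Lemma singleB i : {morph @single I H i : a b / a - b}.
Proof.
move=> a b; apply: functional_extensionality_dep => k; rewrite productB.
have [<-|ik] := pselect (i = k); first by rewrite !single_eq.
by rewrite !single_neq// subrr.
Qed.

Lemma single_finitely_supported i (a : H i) :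
  single a \in finitely_supported (H := H).
Proof.
apply/asboolP/(@sub_finite_set _ _ [set i]); last exact: finite_set1.
move=> k /=; have [//|ik] := pselect (k = i).
by rewrite single_neq ?eqxx//; exact: nesym.
Qed.

Definition direct_incl i (a : H i) : direct_limit tr :=
  subquotient_class _ (SubgroupOf (single_finitely_supported a)).

Fact direct_incl_zmod_morphism i : zmod_morphism (@direct_incl i).
Proof.
move=> a b; rewrite -raddfB; congr subquotient_class; apply: val_inj => /=.
exact: singleB.
Qed.

HB.instance Definition _ i := GRing.isZmodMorphism.Build (H i) (direct_limit tr)
  (@direct_incl i) (@direct_incl_zmod_morphism i).

Lemma direct_incl_tr i i' (a : Arr i i') (x : H i) :
  direct_incl (tr a x) = direct_incl x.
Proof.
apply/eqP; rewrite eq_sym subquotient_classP raddfB /=.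
by apply/asboolP => S; exact.
Qed.

Lemma finitely_supported_ind (P : product H -> Prop) : P 0 ->
  (forall i (a : H i) x, P x -> P (single a + x)) ->
  forall x, x \in finitely_supported (H := H) -> P x.
Proof.
move=> P0 PD x /asboolP/(@finite_seqP {classic I})[r rE].
have rx (i : {classic I}) : i \notin r -> x i = 0.
  apply: contraNeq => xi.
  by have : [set i | x i != 0] i by []; rewrite rE.
elim: r x rx {rE} => [|i r IH] x rx.
  suff -> : x = 0 by [].
  by apply: functional_extensionality_dep => i; exact: rx.
rewrite -(subrK (single (x i)) x) addrC; apply/PD/IH => k kr.
rewrite productB; have [<-|ik] := pselect (i = k).
  by rewrite single_eq subrr.
rewrite single_neq// subr0 rx// inE negb_or kr andbT.
by apply/eqP; exact: nesym.
Qed.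

(** A finitely supported family is a finite sum of [single] terms, so the images of [direct_incl]
    generate the limit. *)
Lemma direct_limit_ext (U : zmodType) (f g : {additive direct_limit tr -> U}) :
  (forall i (a : H i), f (direct_incl a) = g (direct_incl a)) -> f =1 g.
Proof.
move=> fg h; rewrite -(subquotient_reprK h).
case: (subquotient_repr h) => x xS {h}.
(* The class depends on a proof of finite support, so the induction quantifies over that proof. *)
pose P x := forall xf : x \in finitely_supported (H := H),
  f (subquotient_class _ (SubgroupOf xf)) = g (subquotient_class _ (SubgroupOf xf)).
apply: (@finitely_supported_ind P _ _ x xS) => {x xS} [xf|i a x IH xf].
  by rewrite (_ : SubgroupOf xf = 0) ?raddf0//; exact: val_inj.
have xf' : x \in finitely_supported (H := H).
  rewrite -(addKr (single a) x) addrC.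
  by rewrite rpredB ?single_finitely_supported.
rewrite (_ : SubgroupOf xf = SubgroupOf (single_finitely_supported a) +
  SubgroupOf xf'); last exact: val_inj.
by rewrite !raddfD/= IH; congr (_ + _); exact: fg.
Qed.

Section Universal.
Variables (U : zmodType) (f : forall i, {additive H i -> U}).
Hypothesis f_tr : forall i i' (a : Arr i i') (x : H i), f i' (tr a x) = f i x.

Let total x : U := \sum_(i \in [set: {classic I}]) f i (x i).

Let finite_total x : x \in finitely_supported (H := H) ->
  finite_set [set i : {classic I} | f i (x i) != 0].
Proof.
move=> /asboolP; apply: sub_finite_set => i /=.
by apply: contra_neq => ->; rewrite raddf0.
Qed.

Let totalB : {in finitely_supported (H := H) &, {morph total : x y / x - y}}.
Proof.
move=> x y /finite_total xf /finite_total yf; rewrite /total -fsumB//.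
by apply: eq_fsbigr => i _; rewrite -raddfB.
Qed.

Let total_single i (a : H i) : total (single a) = f i a.
Proof.
rewrite /total (@fsum_seq _ _ [:: i : {classic I}])//.
  by rewrite big_cons big_nil in_setT single_eq addr0.
by move=> k; rewrite inE => /eqP ki; rewrite single_neq ?raddf0//; exact: nesym.
Qed.

(** Finite support is part of the condition because additivity of [total] is available only there: a
    sum with infinite support takes the default value 0. *)
Let kernel : {pred product H} :=
  fun x => (x \in finitely_supported (H := H)) && (total x == 0).

Fact total_kernel_closed : zmod_closed kernel.
Proof.
split.
  apply/andP; split; first exact: rpred0.
  by apply/eqP/fsbig1 => i _; rewrite raddf0.
move=> x y /andP[xf /eqP x0] /andP[yf /eqP y0]; apply/andP; split.
  exact: rpredB.
by rewrite totalB// x0 y0 subrr.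
Qed.

HB.instance Definition _ :=
  GRing.isZmodClosed.Build (product H) kernel total_kernel_closed.

(** [identified] is the smallest subgroup containing the relations, so it suffices that the subgroup
    [kernel] contains them. *)
Let total_identified x : x \in identified tr -> total x = 0.
Proof.
move=> /asboolP /(_ kernel) h; apply/eqP.
suff /h/andP[] : forall i i' (a : Arr i i') (x : H i),
  single x - single (tr a x) \in kernel by [].
move=> i i' a z; apply/andP; split.
  by rewrite rpredB ?single_finitely_supported.
rewrite totalB ?single_finitely_supported// !total_single f_tr.
by rewrite subrr.
Qed.

Let desc (h : direct_limit tr) : U := total (val (subquotient_repr h)).

Let descE z : desc (subquotient_class _ z) = total (val z).
Proof.
apply/eqP; rewrite -subr_eq0 -totalB ?(valP z) ?(valP (subquotient_repr _))//.
rewrite total_identified// -raddfB -subquotient_classP.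
by rewrite subquotient_reprK.
Qed.

Fact direct_desc_zmod_morphism : zmod_morphism desc.
Proof.
move=> h k; rewrite -(subquotient_reprK h) -(subquotient_reprK k) -raddfB.
by rewrite !descE raddfB totalB ?(valP (subquotient_repr _)).
Qed.

HB.instance Definition _ := GRing.isZmodMorphism.Build (direct_limit tr) U
  desc direct_desc_zmod_morphism.

Lemma direct_limit_universal : exists u : {additive direct_limit tr -> U},
  forall i (a : H i), u (direct_incl a) = f i a.
Proof. by exists desc => i a; rewrite /= descE total_single. Qed.

End Universal.
End DirectLimit.

(** * Invariance of inverse and direct limits under final functors *)

Section FinalFunctor.
Variables (I : Type) (H : I -> zmodType) (Arr : I -> I -> Type).
Variable tr : forall i i', Arr i i' -> {additive H i -> H i'}.
Variables (J : Type) (K : J -> zmodType) (Brr : J -> J -> Type).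
Variable ur : forall j j', Brr j j' -> {additive K j -> K j'}.
Variables (E : I -> J) (e : forall i i', Arr i i' -> Brr (E i) (E i')).
Variables (phi : forall i, {additive H i -> K (E i)}).
Variables (psi : forall i, {additive K (E i) -> H i}).
Hypothesis phiK : forall i, cancel (phi i) (psi i).
Hypothesis psiK : forall i, cancel (psi i) (phi i).
Hypothesis phi_natural : forall i i' (a : Arr i i') x,
  ur (e a) (phi i x) = phi i' (tr a x).
Hypothesis ur_id : forall j, exists b : Brr j j, forall x, ur b x = x.
Hypothesis ur_comp : forall j j' j'' (b : Brr j j') (b' : Brr j' j''),
  exists b'' : Brr j j'', forall x, ur b'' x = ur b' (ur b x).

Lemma psi_natural i i' (a : Arr i i') x : psi i' (ur (e a) x) = tr a (psi i x).
Proof. by apply: (can_inj (@phiK _)); rewrite psiK -phi_natural psiK. Qed.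

Section InverseLimit.
Hypothesis cofinal : forall j, $| {i & Brr (E i) j} |.
Hypothesis connected : forall i i' j (b : Brr (E i) j) (b' : Brr (E i') j),
  exists k (a : Arr i k) (a' : Arr i' k) (c : Brr (E k) j),
    (forall x, ur c (ur (e a) x) = ur b x) /\
    (forall x, ur c (ur (e a') x) = ur b' x).

Let below j : I := projT1 (unsquash (cofinal j)).
Let proj j : Brr (E (below j)) j := projT2 (unsquash (cofinal j)).

(** Both arrows factor through one [E k], where both components of the thread are carried to
    [phi k (y k)]. Hence [extend] does not depend on the chosen arrows. *)
Lemma thread_connected (y : product H) i i' j (b : Brr (E i) j)
    (b' : Brr (E i') j) : y \in thread tr ->
  ur b (phi i (y i)) = ur b' (phi i' (y i')).
Proof.
move=> /asboolP yT; have [k [a [a' [c [cb cb']]]]] := connected b b'.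
by rewrite -cb -cb' !phi_natural !yT.
Qed.

Let restrict (x : product K) : product H := fun i => psi i (x (E i)).

Let extend (y : product H) : product K :=
  fun j => ur (proj j) (phi _ (y (below j))).

Fact restrict_thread x : x \in thread ur -> restrict x \in thread tr.
Proof.
move=> /asboolP xT; apply/asboolP => i i' a.
by rewrite /restrict -psi_natural xT.
Qed.

Fact extend_thread y : y \in thread tr -> extend y \in thread ur.
Proof.
move=> yT; apply/asboolP => j j' b; rewrite /extend.
have [b' b'E] := ur_comp (proj j) b.
by rewrite -b'E; exact: thread_connected.
Qed.

Let restrict_limit (x : inverse_limit ur) : inverse_limit tr :=
  SubgroupOf (restrict_thread (valP x)).

Fact restrict_limit_zmod_morphism : zmod_morphism restrict_limit.
Proof.
move=> x y; apply: val_inj; apply: functional_extensionality_dep => i /=.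
exact: raddfB.
Qed.

HB.instance Definition _ := GRing.isZmodMorphism.Build _ _ restrict_limit
  restrict_limit_zmod_morphism.

(** The inverse of restriction is [extend]. One composite is the identity because a thread is
    compatible with [proj], the other because [proj (E i)] may be replaced by an identity arrow. *)
Lemma inverse_limit_final : isomorphic (inverse_limit ur) (inverse_limit tr).
Proof.
exists restrict_limit.
exists (fun y => SubgroupOf (extend_thread (valP y))) => x; apply: val_inj.
  apply: functional_extensionality_dep => j /=.
  rewrite /extend /restrict psiK.
  by have /asboolP := valP x; exact.
apply: functional_extensionality_dep => i /=; rewrite /restrict /extend.
apply: (can_inj (@phiK _)); rewrite psiK.
have [b bE] := ur_id (E i).
by rewrite -[RHS]bE; apply: thread_connected; exact: valP.
Qed.

End InverseLimit.

Section DirectLimit.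
Hypothesis cofinal : forall j, $| {i & Brr j (E i)} |.
Hypothesis connected : forall i i' j (b : Brr j (E i)) (b' : Brr j (E i')),
  exists k (a : Arr k i) (a' : Arr k i') (c : Brr j (E k)),
    (forall x, ur (e a) (ur c x) = ur b x) /\
    (forall x, ur (e a') (ur c x) = ur b' x).

Let above j : I := projT1 (unsquash (cofinal j)).
Let incl j : Brr j (E (above j)) := projT2 (unsquash (cofinal j)).

(** Dually to [thread_connected], both classes are represented at [k], by the image of [x] along the
    common factor [c]. *)
Lemma direct_incl_connected i i' j (b : Brr j (E i)) (b' : Brr j (E i')) x :
  direct_incl tr (psi i (ur b x)) = direct_incl tr (psi i' (ur b' x)).
Proof.
have [k [a [a' [c [cb cb']]]]] := connected b b'.
by rewrite -cb -cb' !psi_natural !direct_incl_tr.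
Qed.

(** The universal property gives maps in both directions, one through the chosen arrows [incl], the
    other through [phi]; the composites need only be checked on generators. *)
Lemma direct_limit_final : isomorphic (direct_limit ur) (direct_limit tr).
Proof.
pose f j : {additive K j -> direct_limit tr} :=
  @direct_incl _ _ _ tr (above j) \o psi (above j) \o ur (incl j).
have f_ur j j' (b : Brr j j') x : f j' (ur b x) = f j x.
  rewrite /f /=; have [b' b'E] := ur_comp b (incl j').
  by rewrite -b'E; exact: direct_incl_connected.
pose g i : {additive H i -> direct_limit ur} :=
  @direct_incl _ _ _ ur (E i) \o phi i.
have g_tr i i' (a : Arr i i') x : g i' (tr a x) = g i x.
  by rewrite /g /= -phi_natural direct_incl_tr.
have [u uE] := direct_limit_universal f_ur.
have [v vE] := direct_limit_universal g_tr.
exists u; exists v.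
- apply: (direct_limit_ext (f := v \o u) (g := idfun)) => j x /=.
  by rewrite uE /= vE /= psiK direct_incl_tr.
- apply: (direct_limit_ext (f := u \o v) (g := idfun)) => i x /=.
  rewrite vE /= uE /=; have [b bE] := ur_id (E i).
  by rewrite (direct_incl_connected (incl (E i)) b) bE phiK.
Qed.

End DirectLimit.
End FinalFunctor.

(** * Functoriality of simplicial (co)homology *)

(** Left transparent, like the composite below, so that equalities of vertex maps hold by
    computation. *)
Definition simplicial_id (V : Type) (K L : simplicial_complex V) :
    simplicial_map K L K L.
Proof. by exists id => s; rewrite image_id. Defined.

Definition simplicial_comp (V1 V2 V3 : Type)
    (K1 L1 : simplicial_complex V1) (K2 L2 : simplicial_complex V2)
    (K3 L3 : simplicial_complex V3) (g : simplicial_map K2 L2 K3 L3)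
    (f : simplicial_map K1 L1 K2 L2) : simplicial_map K1 L1 K3 L3.
Proof.
exists (g \o f) => s fs; rewrite -image_comp.
  exact/simplicial_mapK/simplicial_mapK.
exact/simplicial_mapL/simplicial_mapL.
Defined.

Section Functoriality.
Variables (G : zmodType) (n : int).

(** By alternation, the plain sum of a chain over a fibre vanishes at sequences with repetitions, so
    [pushforward] equals that sum everywhere. Composition then amounts to summing over fibres of
    fibres. *)
Lemma pushforward_comp (V1 V2 V3 : choiceType) (f : V1 -> V2) (g : V2 -> V3)
    (K1 : simplicial_complex V1) (c : seq V1 -> G) : chain K1 n c ->
  pushforward (g \o f) c = pushforward g (pushforward f c).
Proof.
move=> [cO ca cf]; have cu v : c v != 0 -> uniq v by move=> /cO[].
rewrite (pushforwardE g); first last.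
- by move=> w /pushforward_neq0[].
- exact: pushforward_supp.
- exact: pushforward_alternating.
rewrite !pushforwardE//; apply/funext => w.
transitivity (\sum_(z \in [set z | map g z = w])
    \sum_(u \in setT `&` map f @^-1` [set z]) c u); last first.
  by apply: eq_fsbigr => z _; rewrite setTI.
rewrite fsum_fibre// setTI; apply: eq_fsbigl.
by apply/seteqP; split=> u /=; rewrite map_comp.
Qed.

Lemma pushforward_id (V : choiceType) (K : simplicial_complex V)
  (c : seq V -> G) : chain K n c -> pushforward id c = c.
Proof.
move=> [cO ca cf]; rewrite pushforwardE//; last by move=> v /cO[].
apply/funext => w; rewrite (_ : [set v | _] = [set w]) ?fsbig_set1//.
by apply/seteqP; split=> v /=; rewrite map_id.
Qed.

(** The inner [pullback] inserts a 0 only when [map f v] has a repetition, by the hypothesis on [f].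
    Its image under [g] then has one too, and [c] is 0 there anyway. *)
Lemma pullback_comp (V1 V2 V3 : choiceType) (f : V1 -> V2) (g : V2 -> V3)
    (K1 : simplicial_complex V1) (K2 : simplicial_complex V2)
    (K3 L3 : simplicial_complex V3) (c : seq V3 -> G) :
  (forall s, simplex K1 s -> simplex K2 (f @` s)) -> cochain K3 L3 n c ->
  pullback (g \o f) K1 c = pullback f K1 (pullback g K2 c).
Proof.
move=> fK [cO _ _]; apply/funext => v; rewrite /pullback.
case: asboolP => // -[vu Kv]; rewrite map_comp; case: asboolP => // fv.
apply/eqP; apply: contra_notT fv => /cO[/map_uniq fu _ _].
by split=> //; exact: simplex_map Kv.
Qed.

Lemma pullback_id (V : choiceType) (K L : simplicial_complex V)
  (c : seq V -> G) : cochain K L n c -> pullback id K c = c.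
Proof.
move=> [cO _ _]; apply/funext => v; rewrite /pullback map_id.
case: asboolP => // Kv; apply/esym/eqP; apply: contra_notT Kv.
by move=> /cO[].
Qed.

Lemma homology_mapE (V1 V2 : choiceType) (K1 L1 : simplicial_complex V1)
    (K2 L2 : simplicial_complex V2) (f : simplicial_map K1 L1 K2 L2) z :
  homology_map G f n (subquotient_class (relative_boundary K1 L1 n) z) =
  subquotient_class (relative_boundary K2 L2 n)
    (subgroup_map (@pushforward_cycle _ _ G _ _ _ _ f n) z).
Proof.
apply: subquotient_mapE; first exact: pushforward_boundary.
exact: pushforward_cycleB.
Qed.

(** Only vertex maps are compared: the induced maps do not depend on the proofs inside a simplicial
    map. *)
Lemma homology_map_comp (V1 V2 V3 : choiceType)
    (K1 L1 : simplicial_complex V1) (K2 L2 : simplicial_complex V2)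
    (K3 L3 : simplicial_complex V3) (f : simplicial_map K1 L1 K2 L2)
    (g : simplicial_map K2 L2 K3 L3) (h : simplicial_map K1 L1 K3 L3) x :
  (h : V1 -> V3) = g \o f ->
  homology_map G h n x = homology_map G g n (homology_map G f n x).
Proof.
move=> hE; rewrite -(subquotient_reprK x) !homology_mapE.
congr subquotient_class; apply: val_inj => /=; rewrite hE.
by have /asboolP[cK _] := valP (subquotient_repr x); exact: pushforward_comp cK.
Qed.

Lemma homology_map_square (V1 V2 V2' V3 : choiceType)
    (K1 L1 : simplicial_complex V1) (K2 L2 : simplicial_complex V2)
    (K2' L2' : simplicial_complex V2') (K3 L3 : simplicial_complex V3)
    (f : simplicial_map K1 L1 K2 L2) (g : simplicial_map K2 L2 K3 L3)
    (f' : simplicial_map K1 L1 K2' L2') (g' : simplicial_map K2' L2' K3 L3) x :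
  (g \o f : V1 -> V3) = g' \o f' ->
  homology_map G g n (homology_map G f n x) =
  homology_map G g' n (homology_map G f' n x).
Proof.
by move=> gf; rewrite -!(homology_map_comp (h := simplicial_comp g f)).
Qed.

Lemma homology_map_id (V : choiceType) (K L : simplicial_complex V)
  (h : simplicial_map K L K L) x : (h : V -> V) = id -> homology_map G h n x = x.
Proof.
move=> hE; rewrite -[RHS]subquotient_reprK -[in LHS](subquotient_reprK x).
rewrite homology_mapE.
congr subquotient_class; apply: val_inj => /=; rewrite hE.
by have /asboolP[cK _] := valP (subquotient_repr x); exact: pushforward_id cK.
Qed.

Lemma cohomology_mapE (V1 V2 : choiceType) (K1 L1 : simplicial_complex V1)
    (K2 L2 : simplicial_complex V2) (f : simplicial_map K1 L1 K2 L2) z :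
  cohomology_map G f n (subquotient_class (relative_coboundary K2 L2 n) z) =
  subquotient_class (relative_coboundary K1 L1 n)
    (subgroup_map (@pullback_cocycle _ _ G _ _ _ _ f n) z).
Proof.
apply: subquotient_mapE; first exact: pullback_coboundary.
exact: pullback_cocycleB.
Qed.

Lemma cohomology_map_comp (V1 V2 V3 : choiceType)
    (K1 L1 : simplicial_complex V1) (K2 L2 : simplicial_complex V2)
    (K3 L3 : simplicial_complex V3) (f : simplicial_map K1 L1 K2 L2)
    (g : simplicial_map K2 L2 K3 L3) (h : simplicial_map K1 L1 K3 L3) x :
  (h : V1 -> V3) = g \o f ->
  cohomology_map G h n x = cohomology_map G f n (cohomology_map G g n x).
Proof.
move=> hE; rewrite -(subquotient_reprK x) !cohomology_mapE.
congr subquotient_class; apply: val_inj => /=; rewrite hE.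
have /asboolP[cK _] := valP (subquotient_repr x).
by apply: pullback_comp cK; exact: simplicial_mapK.
Qed.

Lemma cohomology_map_square (V1 V2 V2' V3 : choiceType)
    (K1 L1 : simplicial_complex V1) (K2 L2 : simplicial_complex V2)
    (K2' L2' : simplicial_complex V2') (K3 L3 : simplicial_complex V3)
    (f : simplicial_map K1 L1 K2 L2) (g : simplicial_map K2 L2 K3 L3)
    (f' : simplicial_map K1 L1 K2' L2') (g' : simplicial_map K2' L2' K3 L3) x :
  (g \o f : V1 -> V3) = g' \o f' ->
  cohomology_map G f n (cohomology_map G g n x) =
  cohomology_map G f' n (cohomology_map G g' n x).
Proof.
by move=> gf; rewrite -!(cohomology_map_comp (h := simplicial_comp g f)).
Qed.

Lemma cohomology_map_id (V : choiceType) (K L : simplicial_complex V)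
  (h : simplicial_map K L K L) x :
  (h : V -> V) = id -> cohomology_map G h n x = x.
Proof.
move=> hE; rewrite -[RHS]subquotient_reprK -[in LHS](subquotient_reprK x).
rewrite cohomology_mapE.
congr subquotient_class; apply: val_inj => /=; rewrite hE.
by have /asboolP[cK _] := valP (subquotient_repr x); exact: pullback_id cK.
Qed.

End Functoriality.

(** * Extension of open sets and covers to the compactification *)

(** A filter on the subspace is pushed forward to [T]. Its cluster point in [A] also clusters in the
    subspace, whose open sets are traces. *)
Lemma set_type_compact (T : topologicalType) (A : set T) :
  compact A -> compact [set: A].
Proof.
move=> cA F FF _.
have vF : fmap (@set_val T A) F A.
  by apply: (@filterS _ F _ setT); [move=> x _; exact: set_valP|exact: filterT].
have [x [Ax clx]] := cA _ (fmap_proper_filter (@set_val _ A) FF) vF.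
exists (exist _ x (mem_set Ax)); split=> // U V FU [_ [[W oW <-] /= Wx WV]].
have [] := clx (@set_val _ A @` U) W.
- by apply: (@filterS _ F _ U) FU => y Uy; exists y.
- by rewrite nbhsE; exists W.
by move=> _ [[y Uy <-] Wy]; exists y; split=> //; exact: WV.
Qed.

Lemma set_type_hausdorff (T : topologicalType) (A : set T) :
  hausdorff_space T -> hausdorff_space A.
Proof.
move=> hT x y xy; apply: val_inj; apply: hT => U V.
have cv := @initial_continuous A T set_val.
by move=> /cv Ux /cv Vy; have [z [Uz Vz]] := xy _ _ Ux Vy; exists (set_val z).
Qed.

(** Near-covering compactness is applied to the filter of finite sequences directed by inclusion:
    once a sequence contains [x], it serves all points of [f x]. *)
Lemma compact_finite_subcover (T : topologicalType) (f : T -> set T) :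
  compact [set: T] -> (forall x, open (f x)) -> (forall x, f x x) ->
  exists s : seq T, forall y, exists2 x, x \in s & f x y.
Proof.
move=> /compact_near_coveringP cT fo fx.
pose F : set_system (seq T) :=
  filter_from setT (fun s : seq T => [set t : seq T | {subset s <= t}]).
have FF : Filter F.
  apply: filter_from_filter; first by exists [::].
  move=> s s' _ _; exists (s ++ s') => // t st.
  by split=> x xs; apply: st; rewrite mem_cat xs ?orbT.
have [|s _ sP] := cT _ F (fun t y => exists2 x, x \in t & f x y) FF.
  move=> x _; exists (f x, [set t | {subset [:: x] <= t}]).
    split; last by exists [:: x].
    by apply: open_nbhs_nbhs; split; [exact: fo|exact: fx].
  by move=> [y t] [/= xy xt]; exists x => //; apply: xt; rewrite inE.
by exists s => y; exact: (sP s).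
Qed.

Lemma dense_closed (T : topologicalType) (S C : set T) :
  dense S -> closed C -> S `<=` C -> C = setT.
Proof.
move=> dS cC SC; apply/seteqP; split=> // x _; apply: contrapT => Cx.
have [y [Cy /SC]] := dS _ (ex_intro _ x Cx) (closed_openC cC).
exact: Cy.
Qed.

Lemma functionally_open_open (R : realType) (X : topologicalType) (U : set X) :
  functionally_open R U -> open U.
Proof.
(* Since [f] is at most 1, the upper bound may be dropped, which leaves an open ray. *)
move=> [f [cf f01 ->]]; rewrite (_ : _ @^-1` _ = f @^-1` `]0, +oo[); last first.
  apply/seteqP; split=> x /=; have := f01 x; rewrite !in_itv/= ?andbT.
    by move=> _ /andP[].
  by move=> /andP[_ ->] ->.
by apply: open_comp; [move=> ? _; exact: cf|exact: interval_open].
Qed.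

Lemma sum_fun_continuous (R : realType) (T : topologicalType) (I : Type)
    (r : seq I) (f : I -> T -> R) : (forall v, continuous (f v)) ->
  continuous (fun x => \sum_(v <- r) f v x).
Proof. by move=> cf; apply: continuous_big => //; exact: add_continuous. Qed.

Section StoneCech.
Variables (R : realType) (X B : topologicalType) (i : X -> B).
Hypothesis iB : stone_cech i.

Lemma stone_cech_continuous : continuous i.
Proof. by apply/continuousP => U oU; apply/(stone_cech_open iB); exists U. Qed.

Lemma unit_interval_extension (f : X -> R) :
  continuous f -> (forall x, f x \in `[0, 1]) ->
  exists2 g : B -> R, continuous g & forall x, g (i x) = f x.
Proof.
move=> cf f01.
(* The extension property needs a compact Hausdorff target, hence the corestriction to the unit
   interval. *)
pose f' x : `[0, 1]%classic : set R := exist _ (f x) (mem_set (f01 x)).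
have cf' : continuous f'.
  apply/continuousP => _ [U oU <-].
  by move/continuousP: cf; exact.
have [||g cg gf] := stone_cech_extension iB _ _ cf'.
- exact/set_type_compact/segment_compact.
- exact/set_type_hausdorff/norm_hausdorff.
exists (set_val \o g); last by move=> x /=; rewrite -[g _]/((g \o i) x) gf.
by move=> b; apply: continuous_comp; [exact: cg|exact: initial_continuous].
Qed.

Definition open_extension (U : set X) : set B := ~` closure (i @` (~` U)).

Lemma open_extension_open U : open (open_extension U).
Proof. exact/closed_openC/closed_closure. Qed.

Lemma open_extensionS U V : U `<=` V -> open_extension U `<=` open_extension V.
Proof.
by move=> UV; apply/subsetC/closureS/image_subset/subsetC.
Qed.

(** Since [X] has the subspace topology, some open set of the compactification has trace [U]; it
    misses the image of the complement of [U] and so keeps [i x] out of the closure. *)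
Lemma open_extensionE U x : open U -> open_extension U (i x) <-> U x.
Proof.
move=> /(stone_cech_open iB)[W oW UW]; split.
  apply: contra_notP => Ux; apply: subset_closure; by exists x.
rewrite {1}UW /= => Wx /(_ W)[]; first exact: open_nbhs_nbhs.
by move=> _ [[y + <-]] Wy; rewrite UW.
Qed.

(** Otherwise the part of the extension outside [C] would be a nonempty open set, and by density it
    would contain a point of [U]. *)
Lemma open_extension_sub_closed U (C : set B) :
  closed C -> open U -> (forall x, U x -> C (i x)) -> open_extension U `<=` C.
Proof.
move=> cC oU UC b Ub; apply: contrapT => Cb.
have [||z [[+ +] [x _ xz]]] :=
    stone_cech_dense iB (O := open_extension U `&` ~` C).
- by exists b.
- by apply: openI; [exact: open_extension_open|exact: closed_openC].
by rewrite -xz => /(open_extensionE _ oU)/UC.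
Qed.

Definition family_extension (a : indexed_family X) : indexed_family B :=
  IndexedFamily (fun v => open_extension (a v)).

Definition refinement_extension b a (p : refinement b a) :
    refinement (family_extension b) (family_extension a) :=
  @Refinement _ (family_extension b) (family_extension a) p
    (fun v => open_extensionS (@projection_sub _ _ _ p v)).

(* The extensions of the functions of a partition of unity subordinate to the
   cover sum to 1 on the dense set X, hence everywhere. *)
Lemma family_extension_covers a :
  functional_covers R X a -> covers (family_extension a).
Proof.
move=> [/(@finite_seqP {classic (idx a)})[r0 r0E] acov afo].
pose r := undup r0.
have rv (v : {classic idx a}) : v \in r.
  by rewrite mem_undup; have : [set: {classic idx a}] v by []; rewrite r0E.
have ur : uniq r by exact: undup_uniq.
pose f (v : {classic idx a}) := projT1 (cid (afo v)).
have fP v : [/\ continuous (f v), forall x, f v x \in `[0, 1] &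
  a v = f v @^-1` `]0, 1]] by exact: (projT2 (cid (afo v))).
have f0 v x : 0 <= f v x.
  by have [_ /(_ x) + _] := fP v; rewrite in_itv => /andP[].
pose s x := \sum_(v <- r) f v x.
have fs v x : f v x <= s x.
  by rewrite /s (bigD1_seq v)//= lerDl sumr_ge0.
have s0 x : 0 < s x.
  have [v vx] := acov x; apply: lt_le_trans (fs v x).
  by move: vx; have [_ _ ->] := fP v; rewrite /= in_itv => /andP[].
(* Normalising by [s] makes the sum identically 1 on [X], an equation that passes to the closure;
   mere positivity of [s] would not. *)
have g_ext v : exists2 g : B -> R, continuous g & forall x, g (i x) = f v x / s x.
  apply: unit_interval_extension.
    move=> x; apply: continuousM; first by have [+ _ _] := fP v; exact.
    apply: continuousV; first by rewrite gt_eqF.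
    by apply: sum_fun_continuous => u; have [] := fP u.
  move=> x; rewrite in_itv/= divr_ge0 ?(ltW (s0 x))//=.
  by rewrite ler_pdivrMr// mul1r.
pose g v := projT1 (cid2 (g_ext v)).
have cg v : continuous (g v) by rewrite /g; case: cid2.
have gE v x : g v (i x) = f v x / s x by rewrite /g; case: cid2 => h ? /=; exact.
have sum1 : [set b | \sum_(v <- r) g v b = 1] = setT.
  apply: (dense_closed (stone_cech_dense iB)).
    apply: (@preimage_closed _ _ _ [set (1 : R)]); last exact: closed_eq.
    by move=> b _; exact: sum_fun_continuous.
  move=> _ [x _ <-] /=; under eq_bigr do rewrite gE.
  by rewrite -mulr_suml -/(s x) divff// gt_eqF.
(* At a point outside all extended sets every [g v] vanishes, because it vanishes on the image of
   the complement of [a v] and hence on its closure. *)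
move=> b; apply: contrapT => /forallNP bN.
have : [set b | \sum_(v <- r) g v b = 1] b by rewrite sum1.
rewrite /= big1; first by move/eqP; rewrite eq_sym oner_eq0.
move=> v _; have /contrapT vb := bN v.
suff : closure (i @` (~` a v)) `<=` g v @^-1` [set 0] by exact.
rewrite [X in _ `<=` X](closure_id _).1.
  apply: closureS => _ [x ax <-] /=; rewrite gE; apply/eqP.
  rewrite mulf_eq0 invr_eq0 (gt_eqF (s0 x)) orbF.
  apply: contra_notT ax => fx; have [_ f01 ->] := fP v.
  have := f01 x; rewrite /= !in_itv/= => /andP[_ ->].
  by rewrite lt0r fx f0.
by apply: preimage_closed; [move=> ? _; exact: cg|exact: closed_eq].
Qed.

(** Each point [b] gets a Urysohn function that is 0 at [b] and 1 off a member of [W] around [b].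
    Finitely many sublevel sets cover, and their traces on [X] form the cover sought. *)
Lemma functional_covers_cofinal W : open_covers B W ->
  exists2 a, functional_covers R X a & $| refinement (family_extension a) W |.
Proof.
move=> [Wc Wo]; have [v vE] := choice Wc.
have sep b : exists f : B -> R, [/\ continuous f, forall z, f z \in `[0, 1],
    f b = 0 & forall z, ~ W (v b) z -> f z = 1].
  have /(@uniform_separatorP _ R)[f [cf f01 fb fW]] :
      uniform_separator [set b] (~` W (v b)).
    apply: (@normal_completely_regular R).
    - apply: compact_normal; first exact: stone_cech_hausdorff iB.
      exact: stone_cech_compact iB.
    - exact/hausdorff_accessible/(stone_cech_hausdorff iB).
    - exact: open_closedC.
    - by apply.
  exists f; split=> //.
  - by move=> z; apply: f01; exists z.
  - by apply: fb; exists b.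
  - by move=> z Wz; apply: fW; exists z.
have [f fP] := choice sep.
(* The threshold lies strictly between the value 0 at [b] and the value 1 off [W (v b)]. *)
pose U b := f b @^-1` `]-oo, 1/2[.
have [s sP] : exists s : seq B, forall y, exists2 x, x \in s & U x y.
  apply: compact_finite_subcover; first exact: stone_cech_compact iB.
    move=> b; apply: open_comp; last exact: interval_open.
    by move=> z _; have [+ _ _ _] := fP b; exact.
  by move=> b; have [_ _ fb _] := fP b; rewrite /U /= in_itv/= fb; lra.
pose t (k : {k | (k < size s)%N}) := tnth (in_tuple s) (Ordinal (svalP k)).
(* Not ['I_(size s)], which lives in too large a universe to index a family *)
pose a := @IndexedFamily X {k | (k < size s)%N} (fun k => i @^-1` U (t k)).
have afo k : functionally_open R (a k).
  have [cf f01 _ _] := fP (t k).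
  (* The positive part of [1 / 2 - f] is nonzero exactly below the threshold. *)
  exists (cst 0 \max (fun x => 1 / 2 - f (t k) (i x))); split.
  - move=> x; apply: (@continuous_max _ _ (cst 0)); first exact: cst_continuous.
    apply: continuousB; first exact: cst_continuous.
    by apply: continuous_comp; [exact: stone_cech_continuous|exact: cf].
  - move=> x; have := f01 (i x); rewrite !in_itv/= => /andP[f0 f1].
    by rewrite le_max lexx/= ge_max; lra.
  - apply/seteqP; split=> x; have := f01 (i x);
      rewrite /a /U /= !in_itv/= lt_max ltxx/= ge_max => /andP[f0 f1]; lra.
exists a.
  split=> [|x|//].
    rewrite (_ : [set: _] = sval @^-1` `I_(size s)); last first.
      by apply/seteqP; split=> k // _; exact: (svalP k).
    apply: finite_preimage (finite_II _) => k k' _ _; exact: val_inj.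
  have [b bs Ub] := sP (i x).
  have bk : (index b s < size s)%N by rewrite index_mem.
  by exists (exist _ (index b s) bk); rewrite /= /t (tnth_nth b) /= nth_index.
apply: squash; exists (fun k => v (t k)) => k.
have [cf _ _ fW] := fP (t k).
(* The strict bound on [X] passes to the extension only as a weak one, which still excludes the
   value 1. *)
have cC : closed (f (t k) @^-1` `]-oo, 1/2]).
  by apply: preimage_closed; [move=> ? _; exact: cf|exact: interval_closed].
move=> b kb.
have : (f (t k) @^-1` `]-oo, 1/2]) b.
  apply: open_extension_sub_closed cC (functionally_open_open (afo k)) _ _ kb.
  by move=> x; rewrite /= /U /= !in_itv/=; exact: ltW.
rewrite /= in_itv/= => fb; apply: contrapT => /fW fb1.
by move: fb; rewrite fb1; lra.
Qed.

End StoneCech.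

(** * Comparison of the limits *)

Section Refinements.
Variables (X : Type).
Implicit Types (a b c : indexed_family X).

Definition refinement_id a : refinement a a := Refinement (fun v => @subset_refl _ (a v)).

Definition refinement_comp c b a (p : refinement b a) (q : refinement c b) :
    refinement c a :=
  @Refinement _ c a (p \o q)
    (fun v => subset_trans (projection_sub q (v := v))
                           (projection_sub p (v := q v))).

(** The sum lies on the coarse side: [a] and [b] refine it, and it refines every family that both
    refine. It provides the index [k] in the hypothesis [connected]. *)
Definition family_sum a b : indexed_family X :=
  @IndexedFamily X (idx a + idx b)
    (fun v => match v with inl v => a v | inr v => b v end).

Definition refinement_inl a b : refinement a (family_sum a b) :=
  @Refinement _ a (family_sum a b) inl (fun v => @subset_refl _ (a v)).

Definition refinement_inr a b : refinement b (family_sum a b) :=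
  @Refinement _ b (family_sum a b) inr (fun v => @subset_refl _ (b v)).

End Refinements.

Lemma functional_covers_sum (R : realType) (X : topologicalType)
    (a b : indexed_family X) :
  functional_covers R X a -> functional_covers R X b ->
  functional_covers R X (family_sum a b).
Proof.
move=> [af ac ao] [bf bc bo]; split; last by case.
  rewrite (_ : [set: _] = inl @` [set: idx a] `|` inr @` [set: idx b]).
    by rewrite finite_setU; split; exact: finite_image.
  by apply/seteqP; split=> // -[v|v] _; [left|right]; exists v.
by move=> x; have [v vx] := ac x; exists (inl v).
Qed.

(** * The nerve pair of an extended cover *)

Section NerveExtension.
Variables (X B : topologicalType) (i : X -> B).
Hypothesis iB : stone_cech i.
Implicit Types (a : indexed_family X) (A : set X).

(** For the converse, finiteness of [s] makes the intersection of the extended members a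
    neighbourhood of each of its points. Containing a point of the closure of the image of [A], it
    meets that image itself. *)
Lemma nerve_simplex_extension A a (s : set {classic idx a}) :
  (forall v, open (a v)) ->
  nerve_simplex A s <->
  nerve_simplex (a := family_extension i a) (closure (i @` A)) s.
Proof.
move=> ao; split=> -[sf s0].
  move=> [x [Ax sx]]; split=> //; exists (i x); split.
    by apply: subset_closure; exists x.
  by move=> v /sx; exact: (open_extensionE iB _ (ao v)).2.
move=> [y [Ay sy]]; split=> //.
have /Ay[_ [[x Ax <-] sx]] : nbhs y (\bigcap_(v in s) family_extension i a v).
  move: sf sy => /finite_fsetP[D ->] sy; apply: filter_bigI => v vD.
  apply: open_nbhs_nbhs; split; first exact: open_extension_open.
  exact: sy.
by exists x; split=> // v /sx; exact: (open_extensionE iB _ (ao v)).1.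
Qed.

(** Lets the full nerve be treated as the case where [A] is all of [X]. *)
Lemma closure_stone_cech : closure (i @` [set: X]) = [set: B].
Proof.
apply: (dense_closed (stone_cech_dense iB)); first exact: closed_closure.
exact: subset_closure.
Qed.

Variables (A : set X) (a : indexed_family X).
Hypothesis ao : forall v, open (a v).

Fact nerve_extension_simplex A' (s : set {classic idx a}) :
  simplex (subnerve A' a) s ->
  simplex (subnerve (closure (i @` A')) (family_extension i a)) (id @` s).
Proof. by rewrite image_id => sA'; exact: (nerve_simplex_extension _ _ ao).1. Qed.

Fact nerve_restriction_simplex A' (s : set {classic idx a}) :
  simplex (subnerve (closure (i @` A')) (family_extension i a)) s ->
  simplex (subnerve A' a) (id @` s).
Proof. by rewrite image_id => sA'; exact: (nerve_simplex_extension _ _ ao).2. Qed.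

Fact nerve_extension_nerve (s : set {classic idx a}) :
  simplex (nerve a) s -> simplex (nerve (family_extension i a)) (id @` s).
Proof.
by rewrite /nerve -closure_stone_cech; exact: nerve_extension_simplex.
Qed.

Fact nerve_restriction_nerve (s : set {classic idx a}) :
  simplex (nerve (family_extension i a)) s -> simplex (nerve a) (id @` s).
Proof.
by rewrite /nerve -closure_stone_cech; exact: nerve_restriction_simplex.
Qed.

(** Both pairs have the same simplices; inverse maps that are the identity on vertices avoid
    transport along an equality of complexes. *)
Definition nerve_extension : simplicial_map (nerve a) (subnerve A a)
    (nerve (family_extension i a))
    (subnerve (closure (i @` A)) (family_extension i a)) :=
  SimplicialMap nerve_extension_nerve (@nerve_extension_simplex A).

Definition nerve_restriction : simplicial_map (nerve (family_extension i a))
    (subnerve (closure (i @` A)) (family_extension i a))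
    (nerve a) (subnerve A a) :=
  SimplicialMap nerve_restriction_nerve (@nerve_restriction_simplex A).

Lemma nerve_extensionK (G : zmodType) n :
  cancel (homology_map G nerve_extension n) (homology_map G nerve_restriction n).
Proof.
move=> x; rewrite -(homology_map_comp (h := simplicial_id (nerve a) (subnerve A a)))//.
exact: homology_map_id.
Qed.

Lemma nerve_restrictionK (G : zmodType) n :
  cancel (homology_map G nerve_restriction n) (homology_map G nerve_extension n).
Proof.
move=> x; rewrite -(homology_map_comp (h := simplicial_id _ _))//.
exact: homology_map_id.
Qed.

Lemma nerve_extensionK_cohomology (G : zmodType) n :
  cancel (cohomology_map G nerve_extension n)
         (cohomology_map G nerve_restriction n).
Proof.
move=> x; rewrite -(cohomology_map_comp (h := simplicial_id _ _))//.
exact: cohomology_map_id.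
Qed.

Lemma nerve_restrictionK_cohomology (G : zmodType) n :
  cancel (cohomology_map G nerve_restriction n)
         (cohomology_map G nerve_extension n).
Proof.
move=> x; rewrite -(cohomology_map_comp (h := simplicial_id _ _))//.
exact: cohomology_map_id.
Qed.

End NerveExtension.

Section Comparison.
Variables (R : realType) (X B : topologicalType) (i : X -> B).
Hypothesis iB : stone_cech i.
Variables (A : set X) (G : zmodType) (n : int).

Let I := cover_index (functional_covers R X).
Let J := cover_index (open_covers B).

Fact functional_cover_open (a : I) v : open (sval a v).
Proof. by have [_ _ ao] := svalP a; exact: functionally_open_open (ao v). Qed.

Fact cover_extension_subproof (a : I) :
  open_covers B (family_extension i (sval a)).
Proof.
split=> [|v]; last exact: open_extension_open.
exact: (family_extension_covers iB (svalP a)).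
Qed.

Definition cover_extension (a : I) : J := exist _ _ (cover_extension_subproof a).

Definition cover_sum (a b : I) : I :=
  exist _ _ (functional_covers_sum (svalP a) (svalP b)).

Definition refinement_sum (a b : I) (w : J)
    (p : refinement (sval (cover_extension a)) (sval w))
    (q : refinement (sval (cover_extension b)) (sval w)) :
  refinement (sval (cover_extension (cover_sum a b))) (sval w) :=
  @Refinement _ (sval (cover_extension (cover_sum a b))) (sval w)
   (fun v => match v with inl v => p v | inr v => q v end)
   (fun v => match v with
     inl v => projection_sub p (v := v) | inr v => projection_sub q (v := v) end).

Lemma cofinal_cover (w : J) :
  $| {a : I & refinement (sval (cover_extension a)) (sval w)} |.
Proof.
have [a aF p] := functional_covers_cofinal R iB (svalP w).
by apply: squash; exists (exist _ a aF); exact: unsquash p.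
Qed.

(** The functor [cover_extension] is final. All squares and triangles to be checked commute already
    on vertices, so functoriality of homology suffices. *)
Lemma cech_functional_homology : isomorphic
  (cech_homology (closure (i @` A)) G n) (functional_homology R A G n).
Proof.
rewrite /cech_homology /functional_homology /limit_homology.
apply: (@inverse_limit_final I _ _ _ J _ _ _ cover_extension
  (fun b a p => refinement_extension i p)
  (fun a => homology_map G (nerve_extension iB A (@functional_cover_open a)) n)
  (fun a => homology_map G (nerve_restriction iB A (@functional_cover_open a)) n)).
- by move=> a; exact: nerve_extensionK.
- by move=> a; exact: nerve_restrictionK.
- by move=> b a p x; exact: homology_map_square.
- by move=> w; exists (refinement_id _) => x; exact: homology_map_id.
- move=> w w' w'' p q; exists (refinement_comp q p) => x.
  exact: homology_map_comp.
- exact: cofinal_cover.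
(* [p] and [q] are the restrictions of [refinement_sum p q] to the two summands. *)
- move=> a b w p q; exists (cover_sum a b), (refinement_inl _ _), (refinement_inr _ _).
  by exists (refinement_sum p q); split=> x; apply/esym; exact: homology_map_comp.
Qed.

(** Pullback reverses the maps: the comparison from the group of [a] to that of its extension is now
    induced by [nerve_restriction]. *)
Lemma cech_functional_cohomology : isomorphic
  (cech_cohomology (closure (i @` A)) G n) (functional_cohomology R A G n).
Proof.
rewrite /cech_cohomology /functional_cohomology /limit_cohomology.
apply: (@direct_limit_final I _ _ _ J _ _ _ cover_extension
  (fun a b p => refinement_extension i p)
  (fun a => cohomology_map G (nerve_restriction iB A (@functional_cover_open a)) n)
  (fun a => cohomology_map G (nerve_extension iB A (@functional_cover_open a)) n)).
- by move=> a; exact: nerve_restrictionK_cohomology.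
- by move=> a; exact: nerve_extensionK_cohomology.
- by move=> a b p x; exact: cohomology_map_square.
- by move=> w; exists (refinement_id _) => x; exact: cohomology_map_id.
- move=> w w' w'' p q; exists (refinement_comp p q) => x.
  exact: cohomology_map_comp.
- exact: cofinal_cover.
- move=> a b w p q; exists (cover_sum a b), (refinement_inl _ _), (refinement_inr _ _).
  by exists (refinement_sum p q); split=> x; apply/esym; exact: cohomology_map_comp.
Qed.

End Comparison.

Theorem corollary2p2 (R : realType) (X betaX : topologicalType)
    (i : X -> betaX) (A : set X) (n : int) (G M : zmodType)
    (X_tychonoff : tychonoff_space X)
    (A_completely_closed : completely_closed R A)
    (i_stone_cech : stone_cech i) :
  (isomorphic (cech_homology (closure (i @` A)) G n) M <->
   isomorphic (functional_homology R A G n) M) /\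
  (isomorphic (cech_cohomology (closure (i @` A)) G n) M <->
   isomorphic (functional_cohomology R A G n) M).
Proof.
split; apply: isomorphic_congr; first exact: cech_functional_homology.
exact: cech_functional_cohomology.
Qed.
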